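(* Let $(M,K)$ be a Cartan space, let $c>0$, and let $i:I(M,K)(c)\hookrightarrow T^*M_0$ be the immersion of the $c$-indicatrix cotangent bundle $I(M,K)(c)$ in $T^*M_0$. Then $I(M,K)(c)$ is a $CR$-submanifold of the almost Kählerian manifold $(T^*M_0,G,J)$, with holomorphic distribution given by $D=H_{\xi^*}\oplus V_{C^*}$ and totally real distribution given by $D^\perp=\{\xi^*\}$.
   Context: Summation convention is used; indices run from $1$ to $n$. $M$ is an $n$-dimensional $C^\infty$ manifold, $(x^i)$ local coordinates on $M$, $(x^i,p_i)$ the induced local coordinates on $T^*M$, and $T^*M_0=T^*M-\{\text{zero section}\}$. A Cartan structure on $M$ is a function $K:T^*M\to[0,\infty)$ such that (i) $K$ is $C^\infty$ on $T^*M_0$; (ii) $K(x,\lambda p)=\lambda K(x,p)$ for all $\lambda>0$; (iii) the matrix $(g^{ij})$, $g^{ij}=\frac12\frac{\partial^2K^2}{\partial p_i\partial p_j}$, is positive definite at all points of $T^*M_0$. (In fact $K(x,p)>0$ for $p\neq 0$.) The pair $(M,K)$ is a Cartan space. The inverse matrix of $(g^{ij})$ is $(g_{ij})$, and $p^i=\frac12\frac{\partial K^2}{\partial p_i}=g^{ij}p_j$. The canonical nonlinear connection has coefficients $N_{ij}=\gamma^0_{ij}-\frac12\gamma^0_{h0}\frac{\partial g_{ij}}{\partial p_h}$, where $\gamma^i_{jk}=\frac12g^{is}\left(\frac{\partial g_{js}}{\partial x^k}+\frac{\partial g_{sk}}{\partial x^j}-\frac{\partial g_{jk}}{\partial x^s}\right)$,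 $\gamma^0_{jk}=\gamma^i_{jk}p_i$, $\gamma^0_{j0}=\gamma^i_{jk}p_ip^k$. It is known that $\frac{\delta K}{\delta x^i}=0$, where $\frac{\delta}{\delta x^i}=\frac{\partial}{\partial x^i}+N_{ij}\frac{\partial}{\partial p_j}$. The horizontal distribution $H(T^*M_0)$ is locally spanned by $\frac{\delta}{\delta x^i}$, and the vertical distribution $V(T^*M_0)$ (kernel of the differential of the projection to $M$) by $\frac{\partial}{\partial p_i}$; the dual coframe is $\{dx^i,\delta p_i=dp_i-N_{ji}dx^j\}$. The Riemannian metric on $T^*M_0$ is $G=g_{ij}dx^i\otimes dx^j+g^{ij}\delta p_i\otimes\delta p_j$, and the almost complex structure $J$ is given by $J\left(\frac{\delta}{\delta x^i}\right)=-g_{ij}\frac{\partial}{\partial p_j}$, $J\left(\frac{\partial}{\partial p_i}\right)=g^{ij}\frac{\delta}{\delta x^j}$; $(T^*M_0,G,J)$ is an almost Kählerian manifold with fundamental form $\Omega=dp_i\wedge dx^i$. $C^*=p_i\frac{\partial}{\partial p_i}$ is the vertical Liouville-Hamilton vector field, $\xi^*=J(C^* )=p^i\frac{\delta}{\delta x^i}$ the horizontal Liouville-Hamilton vector field; $\{C^*\},\{\xi^*\}$ are the line distributions they span. $V_{C^*}$ is the $G$-orthogonal complement of $\{C^*\}$ in $V(T^*M_0)$, locally spanned by $\frac{\overline{\partial}}{\overline{\partial}p_i}=\frac{\partial}{\partial p_i}-\frac{p^i}{K^2}C^*$. $H_{\xi^*}$ is the distribution locally spanned by $\frac{\overline{\delta}}{\overline{\delta}x_i}=J\left(\frac{\overline{\partial}}{\overline{\partial}p_i}\right)=g^{ki}\frac{\delta}{\delta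 x^k}-\frac{p^i}{K^2}\xi^*$, $i=1,\ldots,n$; it is the $(n-1)$-dimensional $G$-orthogonal complement of $\{\xi^*\}$ in $H(T^*M_0)$. In the claim these distributions are considered along $I(M,K)(c)$. For $c>0$ the $c$-indicatrix cotangent bundle is $I(M,K)(c)=\bigcup_{x\in M}\{p\in T_x^*M_0: K(x,p)=c\}$. If $(\widetilde N,\widetilde g,\widetilde J)$ is an (almost) Kähler manifold, a submanifold $N$ of $\widetilde N$ is a $CR$-submanifold if $N$ admits two complementary orthogonal distributions $D$ and $D^\perp$ (so $TN=D\oplus D^\perp$) such that (i) $\widetilde J(D)\subset D$; (ii) $\widetilde J(D^\perp)\subset(TN)^\perp$, where $(TN)^\perp$ is the orthogonal complement of $TN$ in $T\widetilde N$. $D$ is called the maximal complex (holomorphic) distribution and $D^\perp$ the totally real distribution of $N$. *)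

(* Defs.v *)
From HB Require Import structures.
From mathcomp Require Import all_boot all_order all_algebra.
From mathcomp Require Import all_classical all_reals all_analysis.
Set Implicit Arguments.
Unset Strict Implicit.
Unset Printing Implicit Defensive.
Import Order.TTheory GRing.Theory Num.Theory.
Import numFieldNormedType.Exports.
Local Open Scope classical_set_scope.
Local Open Scope ring_scope.

Section Smoothness.
Variables (R : realType) (V W : normedModType R).

Fixpoint Ck (k : nat) (U : set V) (f : V -> W) : Prop :=
  match k with
  | 0 => forall x, U x -> {for x, continuous f}
  | k'.+1 => (forall x, U x -> differentiable f x) /\
             (forall v, Ck k' U (fun x => 'D_v f x))
  end.

(* Only meant for an open U. *)
Definition smooth (U : set V) (f : V -> W) : Prop := forall k, Ck k U f.

End Smoothness.

(* A set with an m-dimensional atlas; the topology is the one induced by the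
   charts ([atlas_open]).  Each point carries a preferred chart [chart_at]:
   a tangent vector at u is represented by its row of components in the chart
   [chart_at u], so every tangent space is 'rV[R]_m.  Components in another
   chart are obtained with [push]. *)
Record atlas (R : realType) (m : nat) := Atlas {
  point : Type;
  chart : Type;
  dom : chart -> set point;
  coord : chart -> point -> 'rV[R]_m;
  chart_at : point -> chart
}.

Section Manifolds.
Variables (R : realType) (m : nat) (A : atlas R m).
Implicit Types (a b : chart A) (u v : point A) (N S : set (point A)).

(* The expression f \o (coord a)^-1 of f in the chart a; it is 0 outside the
   image of the chart. *)
Definition local_expr (W : normedModType R) (f : point A -> W) a :
    'rV[R]_m -> W :=
  fun y => xget 0 [set z | exists u, [/\ dom a u, coord a u = y & f u = z]].

Definition transition a b : 'rV[R]_m -> 'rV[R]_m := local_expr (coord b) a.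

Definition atlas_open S : Prop :=
  forall a, open (coord a @` (dom a `&` S)).

Record is_manifold : Prop := IsManifold {
  chart_atP : forall u, dom (chart_at u) u;
  coord_inj : forall a u v, dom a u -> dom a v -> coord a u = coord a v -> u = v;
  overlap_open : forall a b, open (coord a @` (dom a `&` dom b));
  transition_smooth : forall a b,
    smooth (coord a @` (dom a `&` dom b)) (transition a b);
  atlas_hausdorff : forall u v, u <> v ->
    exists S T, [/\ atlas_open S, atlas_open T, S u, T v & S `&` T = set0];
  atlas_second_countable : exists B : nat -> set (point A),
    (forall k, atlas_open (B k)) /\
    (forall S u, atlas_open S -> S u -> exists2 k, B k u & B k `<=` S)
}.

Definition smooth_fun (f : point A -> R) : Prop :=
  forall a, smooth (coord a @` dom a) (local_expr (f : point A -> R^o) a).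

Definition push a u (X : 'rV[R]_m) : 'rV[R]_m :=
  'd (transition (chart_at u) a) (coord (chart_at u) u) X.

(* Embedded submanifold of dimension d: slice charts. *)
Definition submanifold (d : nat) N : Prop :=
  (d <= m)%N /\
  forall u, N u -> exists (U V : set 'rV[R]_m) (Phi Psi : 'rV[R]_m -> 'rV[R]_m),
    [/\ [/\ open U, open V, U (coord (chart_at u) u) &
            U `<=` coord (chart_at u) @` dom (chart_at u)],
        [/\ smooth U Phi, smooth V Psi, Phi @` U = V &
            forall y, U y -> Psi (Phi y) = y] &
        forall v, dom (chart_at u) v -> U (coord (chart_at u) v) ->
          (N v <-> forall i : 'I_m, (d <= i)%N ->
                     Phi (coord (chart_at u) v) 0 i = 0)].

(* T_u N: velocities at u of the smooth curves in N. *)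
Definition tangent N u (X : 'rV[R]_m) : Prop :=
  exists (gam : R -> point A) (e : R),
    [/\ 0 < e, gam 0 = u,
        forall t, `|t| < e -> N (gam t) /\ dom (chart_at u) (gam t),
        smooth (ball (0 : R^o) e) (coord (chart_at u) \o gam : R^o -> 'rV[R]_m) &
        derive1 (coord (chart_at u) \o gam : R -> 'rV[R]_m) 0 = X].

(* Smooth distribution of rank r on the submanifold N: an r-dimensional
   subspace of T_u N for each u in N, locally spanned by smooth fields. *)
Definition distribution (r : nat) N (D : point A -> {vspace 'rV[R]_m}) : Prop :=
  forall u, N u ->
    [/\ \dim (D u) = r,
        forall X, X \in D u -> tangent N u X &
        exists (U : set 'rV[R]_m) (k : nat) (F : 'I_k -> 'rV[R]_m -> 'rV[R]_m),
          [/\ open U, U (coord (chart_at u) u),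
              U `<=` coord (chart_at u) @` dom (chart_at u),
              forall i, smooth U (F i) &
              forall v, N v -> dom (chart_at u) v -> U (coord (chart_at u) v) ->
                forall X, (X \in D v) =
                  (push (chart_at u) v X \in
                     <<[seq F i (coord (chart_at u) v) | i <- enum 'I_k]>>%VS)]].

(* N is a CR-submanifold of (A, G, J) with holomorphic distribution D and
   totally real distribution D'. *)
Record CR_submanifold (G : point A -> 'rV[R]_m -> 'rV[R]_m -> R)
    (J : point A -> 'rV[R]_m -> 'rV[R]_m) (N : set (point A))
    (D D' : point A -> {vspace 'rV[R]_m}) : Prop := CRSubmanifold {
  CR_sub : exists d, submanifold d N;
  CR_holomorphic_distr : exists r, distribution r N D;
  CR_real_distr : exists r, distribution r N D';
  CR_direct : forall u, N u -> directv (D u + D' u);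
  CR_decomp : forall u, N u ->
    forall X, tangent N u X <-> X \in (D u + D' u)%VS;
  CR_orthogonal : forall u, N u ->
    forall X Y, X \in D u -> Y \in D' u -> G u X Y = 0;
  CR_holomorphic : forall u, N u -> forall X, X \in D u -> J u X \in D u;
  CR_totally_real : forall u, N u ->
    forall X Y, X \in D' u -> tangent N u Y -> G u (J u X) Y = 0
}.

End Manifolds.

Record manifold (R : realType) (n : nat) := Manifold {
  manifold_atlas :> atlas R n;
  manifoldP : is_manifold manifold_atlas
}.

Section CotangentBundle.
Variables (R : realType) (n : nat) (M : manifold R n).

(* A covector at x is represented by its components in the chart
   [chart_at x]. *)
Definition cotangent : Type := (point M * 'rV[R]_n)%type.

(* Components in the chart a: p_i = p'_j (dx'^j / dx^i), where p'_j are the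
   components in the chart x' = [chart_at x]. *)
Definition covector_coord (a : chart M) (u : cotangent) : 'rV[R]_n :=
  \row_i \sum_j u.2 0 j *
    'D_(delta_mx 0 i) (transition a (chart_at u.1)) (coord a u.1) 0 j.

Definition cotangent0 : Type := {u : cotangent | u.2 != 0}.

(* T*M_0 with the induced coordinates (x^i, p_i). *)
Definition cotangent0_atlas : atlas R (n + n) :=
  @Atlas R (n + n) cotangent0 (chart M)
    (fun a => [set u | dom a (val u).1])
    (fun a u => row_mx (coord a (val u).1) (covector_coord a (val u)))
    (fun u => chart_at (val u).1).

End CotangentBundle.

(* The geometric objects of a Cartan space in induced local coordinates.  Here
   L is the local expression of K, y = (x, p) a point of R^(2n), and tangent
   vectors are rows of 2n components in the frame (d/dx^i, d/dp_i). *)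
Section LocalCartan.
Variables (R : realType) (n : nat) (L : 'rV[R]_(n + n) -> R).
Implicit Types (y X Y : 'rV[R]_(n + n)) (f : 'rV[R]_(n + n) -> R).
Implicit Types (i j k : 'I_n).

Definition ddx i : 'rV[R]_(n + n) := delta_mx 0 (lshift n i).
Definition ddp i : 'rV[R]_(n + n) := delta_mx 0 (rshift n i).
Definition pdx i f y : R := 'D_(ddx i) (f : _ -> R^o) y.
Definition pdp i f y : R := 'D_(ddp i) (f : _ -> R^o) y.

Definition p_dn y : 'rV[R]_n := rsubmx y.
Definition K2 y : R := L y ^+ 2.
Definition p_up y i : R := 2^-1 * pdp i K2 y.

Definition g_up y : 'M[R]_n := \matrix_(i, j) (2^-1 * pdp i (pdp j K2) y).
Definition g_dn y : 'M[R]_n := invmx (g_up y).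

Definition gamma y i j k : R :=
  2^-1 * \sum_s g_up y i s *
    (pdx k (fun z => g_dn z j s) y + pdx j (fun z => g_dn z s k) y
     - pdx s (fun z => g_dn z j k) y).
Definition gamma0 y j k : R := \sum_i gamma y i j k * p_dn y 0 i.
Definition gamma00 y j : R := \sum_k gamma0 y j k * p_up y k.

Definition Ncoef y i j : R :=
  gamma0 y i j - 2^-1 * \sum_h gamma00 y h * pdp h (fun z => g_dn z i j) y.

Definition deltax y i : 'rV[R]_(n + n) := ddx i + \sum_j Ncoef y i j *: ddp j.

Definition dx i X : R := X 0 (lshift n i).
Definition deltap y i X : R := X 0 (rshift n i) - \sum_j Ncoef y j i * dx j X.

Definition metric y X Y : R :=
  \sum_i \sum_j g_dn y i j * dx i X * dx j Y
  + \sum_i \sum_j g_up y i j * deltap y i X * deltap y j Y.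

(* Linear extension of J (delta/delta x^i) = - g_ij d/dp_j and
   J (d/dp_i) = g^ij delta/delta x^j, in the adapted coframe
   (dx^i, delta p_i). *)
Definition acs y X : 'rV[R]_(n + n) :=
  \sum_i dx i X *: (- \sum_j g_dn y i j *: ddp j)
  + \sum_i deltap y i X *: (\sum_j g_up y i j *: deltax y j).

Definition liouville_v y : 'rV[R]_(n + n) := \sum_i p_dn y 0 i *: ddp i.
Definition liouville_h y : 'rV[R]_(n + n) := acs y (liouville_v y).

Definition vertical : {vspace 'rV[R]_(n + n)} :=
  <<[seq ddp i | i <- enum 'I_n]>>%VS.

Definition V_C y : {vspace 'rV[R]_(n + n)} :=
  (vertical :&: lker (linfun (metric y (liouville_v y) : _ -> R^o)))%VS.

Definition barp y i : 'rV[R]_(n + n) :=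
  ddp i - (p_up y i / K2 y) *: liouville_v y.
Definition barx y i : 'rV[R]_(n + n) := acs y (barp y i).

Definition H_xi y : {vspace 'rV[R]_(n + n)} :=
  <<[seq barx y i | i <- enum 'I_n]>>%VS.

(* [linfun] is only meaningful for a linear argument, hence this check. *)
Lemma memV_C y X :
  (X \in V_C y) = (X \in vertical) && (metric y (liouville_v y) X == 0).
Proof.
have lin : linear (metric y (liouville_v y) : _ -> R^o).
  have dxP i : linear (dx i : _ -> R^o) by move=> c x z; rewrite /dx !mxE.
  have dpP i : linear (deltap y i : _ -> R^o).
    move=> c x z; rewrite /deltap !mxE scalerBr addrACA -opprD; congr (_ - _).
    rewrite scaler_sumr -big_split; apply: eq_bigr => j _ /=.
    by rewrite dxP mulrDr /GRing.scale /= mulrCA.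
  move=> c x z; rewrite /metric scalerDr addrACA; congr (_ + _);
    rewrite scaler_sumr -big_split; apply: eq_bigr => i _ /=;
    rewrite scaler_sumr -big_split; apply: eq_bigr => j _ /=.
    by rewrite dxP mulrDr /GRing.scale /= mulrCA.
  by rewrite dpP mulrDr /GRing.scale /= mulrCA.
pose F := GRing.isLinear.Build R 'rV[R]_(n + n) R^o _
  (metric y (liouville_v y) : _ -> R^o) lin.
pose f : {linear 'rV[R]_(n + n) -> R^o} :=
  HB.pack (metric y (liouville_v y) : 'rV[R]_(n + n) -> R^o) F.
by rewrite memv_cap memv_ker (lfunE f).
Qed.

End LocalCartan.

Section Cartan.
Variables (R : realType) (n : nat) (M : manifold R n).
Variable K : cotangent M -> R.

Local Notation TM0 := (cotangent0_atlas M).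

Definition K0 (u : point TM0) : R := K (val u).

Definition K_loc (a : chart M) : 'rV[R]_(n + n) -> R :=
  @local_expr R (n + n) TM0 R^o K0 a.

Record cartan_structure : Prop := CartanStructure {
  cartan_ge0 : forall u, 0 <= K u;
  cartan_smooth : @smooth_fun R (n + n) TM0 K0;
  cartan_homogeneous : forall x p (l : R), 0 < l -> K (x, l *: p) = l * K (x, p);
  cartan_posdef : forall (a : chart TM0) (u : point TM0), dom a u ->
    forall v : 'rV[R]_n, v != 0 ->
      0 < \sum_i \sum_j g_up (K_loc a) (coord a u) i j * v 0 i * v 0 j
}.

Definition indicatrix (c : R) : set (point TM0) := [set u | K0 u = c].

(* Each object at u is given by its expression in the chart [chart_at u].
   [chart_at] is an arbitrary choice of charts around the points of M. *)
Definition cartan_metric (u : point TM0) : 'rV[R]_(n + n) -> 'rV[R]_(n + n) -> R :=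
  metric (K_loc (chart_at u)) (coord (chart_at u) u).

Definition cartan_acs (u : point TM0) : 'rV[R]_(n + n) -> 'rV[R]_(n + n) :=
  acs (K_loc (chart_at u)) (coord (chart_at u) u).

Definition H_xi_distr (u : point TM0) : {vspace 'rV[R]_(n + n)} :=
  H_xi (K_loc (chart_at u)) (coord (chart_at u) u).

Definition V_C_distr (u : point TM0) : {vspace 'rV[R]_(n + n)} :=
  V_C (K_loc (chart_at u)) (coord (chart_at u) u).

Definition xi_distr (u : point TM0) : {vspace 'rV[R]_(n + n)} :=
  <[liouville_h (K_loc (chart_at u)) (coord (chart_at u) u)]>%VS.

End Cartan.

(* Main.v *)
(** Put [theta = p_i dx^i].  Euler's identities and the symmetry of second
    derivatives give [delta K / delta x^i = 0], hence
    [G(X, xi^* ) = theta(X)] and [G(C^*, X) = K dK(X)].  Consequently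
    [D = ker dK /\ ker theta] and [T I = ker dK = D + <xi^*>], and the
    CR conditions are linear algebra in the adapted frame.

    For the smoothness of the distributions, no transformation law of the
    nonlinear connection is needed: [dK] and [theta] are invariant under a
    change of induced coordinates, and [xi^*] is the Hamiltonian field of
    [K^2/2], which is invariant because coordinate changes preserve [d theta].
    The homogeneity of [K] yields both the slice charts of the indicatrix and
    the curves realizing a given tangent vector, by rescaling covectors. *)
Require Import Defs.
From mathcomp Require Import all_boot all_order all_algebra.
From mathcomp Require Import all_classical all_reals all_analysis.
From mathcomp Require Import perm ring.
Set Implicit Arguments.
Unset Strict Implicit.
Unset Printing Implicit Defensive.
Import Order.TTheory GRing.Theory Num.Theory.
Import numFieldNormedType.Exports Defs.
Local Open Scope classical_set_scope.
Local Open Scope ring_scope.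

(** * Calculus of [Ck] and [smooth] functions *)

(** The encoding of tangent spaces shapes the proof. At each point [v] vectors are rows in the chart
    [chart_at v], an arbitrary choice that need not vary continuously, while a distribution must be
    spanned near [u] by smooth fields read in the single chart [chart_at u]. Every subspace is
    therefore described by data that survive a change of chart. For [D] these are the equations
    [dK = 0] and [theta = 0]; the spanning fields are the coordinate frame projected along C^* and
    xi^*, that is 2n generators for rank 2n - 2, which spares the choice of a basis. For xi^* the
    datum is Hamilton's equation. Tangent vectors are velocities of curves and submanifolds are
    given by slice charts, so both must be produced explicitly. Radial scaling does this by a
    division by [K], in place of an implicit function theorem. Symmetry of second derivatives serves
    both for [g^ij] and for the invariance of d theta; it is derived from the mean value theorem. *)

Section Ck_theory.
Variables (R : realType) (V : normedModType R).
Implicit Types (U : set V) (k : nat).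

Lemma near_eq_differentiable (W : normedModType R) (f g : V -> W) x :
  {near x, f =1 g} -> differentiable f x -> differentiable g x.
Proof.
move=> fg df.
have [dfc dfE] := (diff_locallyP _ _).1 df.
have gE : g \o shift x = cst (g x) + 'd f x +o_ 0 id.
  apply/eqaddoP => e e0; move/eqaddoP: dfE => /(_ e e0) dfE.
  have fgx : f x = g x by exact: nbhs_singleton fg.
  have : \forall h \near 0, f (h + x) = g (h + x).
    move: fg; rewrite (near_shift 0 x) /=.
    by apply: filterS => h; rewrite subr0.
  move=> fgn; near=> h.
  have -> : (g \o shift x - (cst (g x) + 'd f x)) h =
            (f \o shift x - (cst (f x) + 'd f x)) h.
    rewrite !fctE /= fgx; congr (_ - _).
    by rewrite (near fgn h).
  by near: h.
(* The expansion [gE] identifies the differential of [g] with that of [f], which turns [gE] into the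
   criterion required of [g]. *)
by apply/diff_locallyP; rewrite (diff_unique dfc gE).
Unshelve. all: by end_near. Qed.

Section General.
Variable W : normedModType R.
Implicit Types f g : V -> W.

Lemma eq_near_open U f g x : open U -> U x -> (forall y, U y -> f y = g y) ->
  {near x, f =1 g}.
Proof.
move=> oU Ux fg; have : nbhs x U by exact: open_nbhs_nbhs.
by apply: filterS.
Qed.

Lemma eq_derive_open U f g x v : open U -> U x ->
  (forall y, U y -> f y = g y) -> 'D_v f x = 'D_v g x.
Proof. by move=> oU Ux fg; apply: near_eq_derive; exact: (eq_near_open oU). Qed.

Lemma eq_Ck k U f g : open U -> (forall x, U x -> f x = g x) ->
  Ck k U f -> Ck k U g.
Proof.
move=> oU; elim: k f g => [|k IH] f g fg /=.
  move=> fc x Ux.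
  have fgx := eq_near_open oU Ux fg.
  have := fc x Ux; rewrite /prop_for /continuous_at (fg x Ux).
  by apply: cvg_trans; apply: near_eq_cvg; exact: filterS fgx.
move=> [fd fk]; split.
  by move=> x Ux; apply: near_eq_differentiable (fd x Ux); exact: (eq_near_open oU).
by move=> v; apply: IH (fk v) => x Ux; exact: (eq_derive_open v oU).
Qed.

Lemma CkS k U f : Ck k.+1 U f -> Ck k U f.
Proof.
elim: k f => [|k IH] f /= [fd fk].
  by move=> x Ux; apply: differentiable_continuous; exact: fd.
by split => // v; apply: IH.
Qed.

Lemma Ck_diff k U f x : Ck k.+1 U f -> U x -> differentiable f x.
Proof. by case=> + _; apply. Qed.

Lemma sub_Ck k U U' f : U' `<=` U -> Ck k U f -> Ck k U' f.
Proof.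
move=> UU; elim: k f => [|k IH] f /=; first by move=> fc x /UU; exact: fc.
by case=> fd fk; split=> [x /UU|v]; [exact: fd | exact: IH].
Qed.

Lemma Ck_cst k U (a : W) : Ck k U (fun=> a).
Proof.
elim: k a => [|k IH] a /=; first by move=> x _; exact: cst_continuous.
split=> [x _|v]; first exact: differentiable_cst.
by have -> : 'D_v (fun=> a) = (fun=> 0) :> (V -> W)
  by apply/funext => x; exact: derive_cst.
Qed.

Lemma CkD k U f g : open U -> Ck k U f -> Ck k U g ->
  Ck k U (fun x => f x + g x).
Proof.
move=> oU; elim: k f g => [|k IH] f g.
  by move=> fc gc x Ux; exact: cvgD (fc x Ux) (gc x Ux).
move=> [fd fk] [gd gk]; split=> [x Ux|v].
  by apply: differentiableD; [exact: fd | exact: gd].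
apply: eq_Ck (IH _ _ (fk v) (gk v)) => // x Ux.
by rewrite -[RHS]/('D_v (f + g) x) deriveD //; apply: diff_derivable;
  [exact: fd | exact: gd].
Qed.

Lemma Ck_sum k U (I : Type) (r : seq I) (P : pred I) (F : I -> V -> W) :
  open U -> (forall i, Ck k U (F i)) ->
  Ck k U (fun x => \sum_(i <- r | P i) F i x).
Proof.
move=> oU FC; elim: r => [|i r IH].
  by apply: eq_Ck (Ck_cst k U (0 : W)) => // x _; rewrite big_nil.
case Pi: (P i); last by apply: eq_Ck IH => // x _; rewrite big_cons Pi.
by apply: eq_Ck (CkD oU (FC i) IH) => // x _; rewrite big_cons Pi.
Qed.

Lemma Ck_linear k U (f : {linear V -> W}) : continuous f -> Ck k U f.
Proof.
move=> fc; case: k => [|k]; first by move=> x _; exact: fc.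
split=> [x _|v]; first exact: linear_differentiable.
have -> : (fun x => 'D_v f x) = (fun=> f v).
  apply/funext => x; rewrite deriveE ?diff_lin //.
  exact: linear_differentiable.
exact: Ck_cst.
Qed.

End General.

Section Scalar.
Implicit Types f g : V -> R^o.

Lemma CkM k U f g : open U -> Ck k U f -> Ck k U g ->
  Ck k U (fun x => f x * g x : R^o).
Proof.
move=> oU; elim: k f g => [|k IH] f g.
  by move=> fc gc x Ux; exact: cvgM (fc x Ux) (gc x Ux).
move=> fC gC; have [fd fk] := fC; have [gd gk] := gC; split=> [x Ux|v].
  by apply: (differentiableM (fd _ Ux) (gd _ Ux)).
apply: eq_Ck (CkD oU (IH _ _ (CkS fC) (gk v)) (IH _ _ (CkS gC) (fk v))) => //.
move=> x Ux; rewrite -[RHS]/('D_v (f * g) x) deriveM //.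
  exact/diff_derivable/fd.
exact/diff_derivable/gd.
Qed.

Lemma Ck_prod k U (I : Type) (r : seq I) (P : pred I) (F : I -> V -> R^o) :
  open U -> (forall i, Ck k U (F i)) ->
  Ck k U (fun x => \prod_(i <- r | P i) F i x : R^o).
Proof.
move=> oU FC; elim: r => [|i r IH].
  by apply: eq_Ck (Ck_cst k U (1 : R^o)) => // x _; rewrite big_nil.
case Pi: (P i); last by apply: eq_Ck IH => // x _; rewrite big_cons Pi.
by apply: eq_Ck (CkM oU (FC i) IH) => // x _; rewrite big_cons Pi.
Qed.

Lemma CkN k U f : open U -> Ck k U f -> Ck k U (fun x => - f x : R^o).
Proof.
move=> oU fC; apply: eq_Ck (CkM oU (Ck_cst k U (-1 : R^o)) fC) => // x _.
by rewrite mulN1r.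
Qed.

(** The derivative of [1/f] is [- (1/f)^2 * 'D_v f], where [1/f] itself comes back: the induction on
    [k] can keep [f] fixed. *)
Lemma CkV k U f : open U -> (forall x, U x -> f x != 0) -> Ck k U f ->
  Ck k U (fun x => (f x)^-1 : R^o).
Proof.
move=> oU f0; elim: k => [|k IH].
  by move=> fc x Ux; exact: cvgV (f0 x Ux) (fc x Ux).
move=> fC; have [fd fk] := fC; split=> [x Ux|v].
  by apply: differentiableV; [exact: fd | exact: f0].
have fV := IH (CkS fC).
apply: eq_Ck (CkN oU (CkM oU (CkM oU fV fV) (fk v))) => // x Ux.
rewrite deriveV ?f0 //; last exact/diff_derivable/fd.
by rewrite -invfM -expr2 -[RHS]/(- (f x) ^- 2 * 'D_v f x) mulNr.
Qed.

End Scalar.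

Lemma derive_mxE m (f : V -> 'rV[R]_m) x v i : differentiable f x ->
  ('D_v f x) 0 i = 'D_v (fun y => f y 0 i : R^o) x.
Proof. by move=> fd; rewrite derive_mx ?mxE //; exact: diff_derivable. Qed.

Lemma differentiable_rV m (f : V -> 'rV[R]_m) x :
  (forall i, differentiable (fun y => f y 0 i : R^o) x) -> differentiable f x.
Proof.
move=> fd; have -> : f = \sum_(i < m) (fun y => f y 0 i *: delta_mx 0 i).
  apply/funext => y; rewrite fct_sumE; exact: row_sum_delta.
by apply: differentiable_sum => i; apply: differentiableZl.
Qed.

Lemma differentiable_rVE m (f : V -> 'rV[R]_m) x i :
  differentiable f x -> differentiable (fun y => f y 0 i : R^o) x.
Proof.
move=> fd; apply: (@differentiable_comp _ _ _ _ f
  ((fun A : 'rV[R]_m => A 0 i) : _ -> R^o)) => //.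
exact: differentiable_coord.
Qed.

Lemma Ck_rV k U m (f : V -> 'rV[R]_m) : open U ->
  (forall i, Ck k U (fun y => f y 0 i : R^o)) -> Ck k U f.
Proof.
move=> oU; elim: k f => [|k IH] f fC.
  apply: (@eq_Ck _ 0 U (fun y => \sum_(i < m) f y 0 i *: delta_mx 0 i)) => //.
    by move=> x _; rewrite -row_sum_delta.
  apply: Ck_sum => // i x Ux.
  by apply: cvgZr_tmp; exact: fC.
have fd x : U x -> differentiable f x.
  by move=> Ux; apply: differentiable_rV => i; have [+ _] := fC i; apply.
split=> // v; apply: IH => i; have [_ /(_ v)] := fC i.
by apply: eq_Ck => // x Ux; rewrite derive_mxE //; exact: fd.
Qed.

Lemma Ck_rVE k U m (f : V -> 'rV[R]_m) i : open U ->
  Ck k U f -> Ck k U (fun y => f y 0 i : R^o).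
Proof.
move=> oU; elim: k f => [|k IH] f.
  move=> fC x Ux; apply: (@continuous_comp _ _ _ f (fun A : 'rV[R]_m => A 0 i)).
    exact: fC.
  exact: coord_continuous.
move=> [fd fk]; split=> [x Ux|v]; first by apply: differentiable_rVE; exact: fd.
by apply: eq_Ck (IH _ (fk v)) => // x Ux; rewrite derive_mxE //; exact: fd.
Qed.

End Ck_theory.

Section Chain.
Variables (R : realType) (V : normedModType R) (m : nat).

Lemma derive_sumE (W : normedModType R) (f : 'rV[R]_m -> W) y v :
  differentiable f y -> 'D_v f y = \sum_i v 0 i *: 'D_(delta_mx 0 i) f y.
Proof.
move=> fd; rewrite deriveE // {1}(row_sum_delta v) linear_sum.
by apply: eq_bigr => i _; rewrite linearZ -deriveE.
Qed.

Lemma derive_comp (W : normedModType R) (f : 'rV[R]_m -> W)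
    (g : V -> 'rV[R]_m) x v :
  differentiable g x -> differentiable f (g x) ->
  'D_v (f \o g) x = 'D_('D_v g x) f (g x).
Proof.
move=> gd fd; rewrite !deriveE //; last exact: differentiable_comp.
by rewrite diff_comp.
Qed.

(** By the chain rule the derivative is a sum of products of components of ['D_v g] with partial
    derivatives of [f] composed with [g], so the induction varies [f] and keeps [g]. Values are
    scalar because the product rule is; vector-valued maps go through [Ck_rV]. *)
Lemma Ck_comp k (U : set V) (O : set 'rV[R]_m) (f : 'rV[R]_m -> R^o)
    (g : V -> 'rV[R]_m) : open U -> open O ->
  (forall x, U x -> O (g x)) -> Ck k O f -> Ck k U g -> Ck k U (f \o g).
Proof.
move=> oU oO UO; elim: k f => [|k IH] f.
  by move=> fC gC x Ux; apply: continuous_comp; [exact: gC | exact/fC/UO].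
move=> [fd fk] gC; have [gd gk] := gC; split=> [x Ux|v].
  by apply: differentiable_comp; [exact: gd | exact/fd/UO].
apply: (@eq_Ck _ _ _ k U (fun x => \sum_i ('D_v g x) 0 i *
          ((fun z => 'D_(delta_mx 0 i) f z) \o g) x : R^o)) => //.
  move=> x Ux; have fdx := fd _ (UO _ Ux); have gdx := gd _ Ux.
  by rewrite derive_comp // derive_sumE.
apply: Ck_sum => // i; apply: CkM => //; first exact: Ck_rVE (gk v).
by apply: IH; [exact: fk | exact: CkS].
Qed.

End Chain.

(** * Symmetry of second derivatives *)

Section Schwarz.
Variables (R : realType) (V : normedModType R).
Implicit Types (U : set V) (f : V -> R^o).

Lemma directional_MVT f x u (h : R) : 0 < h ->
  (forall t, 0 <= t <= h -> differentiable f (x + t *: u)) ->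
  exists2 s, 0 < s < h & f (x + h *: u) - f x = h * 'D_u f (x + s *: u).
Proof.
move=> h0 fd; pose g (t : R^o) := x + t *: u.
have gd t : is_diff t g (0 + ( *:%R ^~ u)).
  exact: (is_diffD (is_diff_cst x t) (is_diff_scalel t u)).
have dfg t : 0 <= t <= h -> is_derive (t : R^o) 1 (f \o g) ('D_u f (g t)).
  move=> th; have fdt : differentiable f (g t) by exact: fd.
  have fgd : differentiable (f \o g) t by apply: differentiable_comp.
  apply: DeriveDef; first exact: diff_derivable.
  by rewrite deriveE // diff_comp //= diff_val fctE add0r scale1r deriveE.
have [||s sh] := @MVT R (f \o g) (fun t => 'D_u f (g t)) 0 h h0.
- by move=> t; rewrite in_itv /= => /andP[t0 th]; apply: dfg; rewrite !ltW.
- apply: derivable_within_continuous => t; rewrite in_itv /= => th.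
  by have [] := dfg t th.
rewrite /g /= scale0r addr0 subr0 mulrC => E.
by exists s; [rewrite in_itv in sh | ].
Qed.

(* Exchanging [u] and [v] fixes the left-hand side. *)
Lemma second_difference U f x u v (h : R) : 0 < h -> open U -> Ck 2 U f ->
  (forall s t, 0 <= s <= h -> 0 <= t <= h -> U (x + s *: u + t *: v)) ->
  exists s t, [/\ 0 < s < h, 0 < t < h &
    f (x + h *: u + h *: v) - f (x + h *: u) - (f (x + h *: v) - f x) =
    h * (h * 'D_v (fun y => 'D_u f y) (x + s *: u + t *: v))].
Proof.
move=> h0 oU [fd fk] Ust; pose F (y : V) : R^o := f (y + h *: v) - f y.
have hh : 0 <= h <= h by rewrite ltW /=.
have z0 : 0 <= (0 : R) <= h by rewrite lexx ltW.
have shd s : 0 <= s <= h -> differentiable (fun y : V => f (y + h *: v)) (x + s *: u).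
  move=> sh; apply: (@differentiable_comp _ _ _ _ (fun y : V => y + h *: v) f).
    by apply: ex_diff.
  exact/fd/Ust.
have fd0 s : 0 <= s <= h -> differentiable f (x + s *: u).
  by move=> sh; have := fd _ (Ust s 0 sh z0); rewrite scale0r addr0.
(* The second difference is the increment of [F] along [u]. A first mean value produces ['D_u F],
   which is an increment of ['D_u f] along [v], so the theorem applies again. *)
have [|s sh] := @directional_MVT F x u h h0.
  by move=> t th; apply: differentiableB; [exact: shd | exact: fd0].
have sh' : 0 <= s <= h by case/andP: sh => *; rewrite !ltW.
have dshift : 'D_u (fun y : V => f (y + h *: v)) (x + s *: u) =
              'D_u f (x + s *: u + h *: v).
  have fdx := fd _ (Ust s h sh' hh).
  rewrite (deriveE _ (shd _ sh')) (deriveE _ fdx).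
  by rewrite (@diff_comp _ _ _ _ (fun y : V => y + h *: v) f) //= diff_val /= addr0.
have -> : 'D_u F (x + s *: u) = 'D_u f (x + s *: u + h *: v) - 'D_u f (x + s *: u).
  rewrite -dshift -[F]/((fun y : V => f (y + h *: v) : R^o) - f) deriveB //.
    exact/diff_derivable/shd.
  exact/diff_derivable/fd0.
rewrite /F => ->.
have [|t th ->] := @directional_MVT (fun y => 'D_u f y) (x + s *: u) v h h0.
  by move=> t th; have [+ _] := fk u; apply; exact: Ust.
by exists s, t.
Qed.

(** By the triangle inequality at [w] the two bounds contradict each other; the conclusion is stated
    in the form that [derive_comm] has to refute. *)
Lemma half_dist_eq (a b w : R) :
  `|a - w| < `|a - b| / 2 -> `|b - w| < `|a - b| / 2 -> a - b == 0.
Proof.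
move=> A1 A2; have : `|a - b| <= `|a - w| + `|b - w|.
  by rewrite [X in `|X|](_ : _ = (a - w) - (b - w)) ?ler_normB //; ring.
by rewrite leNgt {1}[`|a - b|]splitr ltrD.
Qed.

(** The second difference over a small parallelogram at [x] is [h^2] times either mixed derivative,
    each taken at some point of the parallelogram. Both are continuous at [x], so for small [h]
    distinct values at [x] could not have this common value. *)
Lemma derive_comm U f x u v : open U -> Ck 2 U f -> U x ->
  'D_v (fun y => 'D_u f y) x = 'D_u (fun y => 'D_v f y) x.
Proof.
move=> oU fC Ux; have [_ fk] := fC.
have cvu : {for x, continuous (fun y => 'D_v (fun y => 'D_u f y) y)}.
  by have [_ /(_ v)] := fk u; apply.
have cuv : {for x, continuous (fun y => 'D_u (fun y => 'D_v f y) y)}.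
  by have [_ /(_ u)] := fk v; apply.
apply/eqP; rewrite -subr_eq0; apply/negPn/negP => ne.
set a := 'D_v _ x in ne *; set b := 'D_u _ x in ne *.
have e0 : 0 < `|a - b| / 2 by rewrite divr_gt0 // normr_gt0.
have nn : nbhs x (U `&`
    ([set y | `|a - 'D_v (fun y => 'D_u f y) y| < `|a - b| / 2] `&`
     [set y | `|b - 'D_u (fun y => 'D_v f y) y| < `|a - b| / 2])).
  apply: filterI; first exact: open_nbhs_nbhs.
  by apply: filterI; [move/cvgrPdist_lt : cvu | move/cvgrPdist_lt : cuv]; apply.
have /nbhs_ballP[r /= r0 rP] := nn.
(* With this size [|s u + t v|] is at most [r / 2] for [s] and [t] up to [h]; the summand 1 keeps
   the divisor positive when [u] and [v] vanish. *)
pose h := r / 2 / (`|u| + `|v| + 1).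
have d0 : 0 < `|u| + `|v| + 1 by rewrite ltr_wpDl // addr_ge0.
have h0 : 0 < h by rewrite !divr_gt0.
have inb s t : 0 <= s <= h -> 0 <= t <= h -> ball x r (x + s *: u + t *: v).
  move=> /andP[s0 sh] /andP[t0 th]; rewrite -ball_normE /=.
  rewrite -addrA opprD addrA subrr add0r normrN.
  apply: le_lt_trans (ler_normD _ _) _; rewrite !normrZ !ger0_norm //.
  apply: (@le_lt_trans _ _ (h * (`|u| + `|v| + 1))).
    rewrite !mulrDr -[leLHS]addr0; apply: lerD; last by rewrite mulr1 ltW.
    by apply: lerD; apply: ler_wpM2r.
  by rewrite /h divfK ?gt_eqF // gtr_pMr // invf_lt1 // ltr1n.
have inb' s t : 0 < s < h -> 0 < t < h -> ball x r (x + s *: u + t *: v).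
  by move=> /andP[s0 sh] /andP[t0 th]; apply: inb; rewrite !ltW.
have [|s [t [sh th E1]]] := @second_difference U f x u v h h0 oU fC.
  by move=> s t sh th; have [] := rP _ (inb s t sh th).
have [|s' [t' [sh' th' E2]]] := @second_difference U f x v u h h0 oU fC.
  move=> s' t' sh' th'; rewrite addrAC.
  by have [] := rP _ (inb t' s' th' sh').
have [_ [A1 _]] := rP _ (inb' s t sh th).
have := rP _ (inb' t' s' th' sh'); rewrite addrAC => -[_ [_ A2]].
have hn0 : h != 0 by rewrite gt_eqF.
have E : h * (h * 'D_v (fun y => 'D_u f y) (x + s *: u + t *: v)) =
         h * (h * 'D_u (fun y => 'D_v f y) (x + s' *: v + t' *: u)).
  apply: etrans (esym E1) (etrans _ E2).
  rewrite -[x + h *: v + _]addrA [h *: v + _]addrC addrA.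
  move: (f _) (f _) (f _) (f _) => p q r' s''.
  by rewrite !opprB !addrA; ring.
apply: (negP ne); apply: half_dist_eq A1 _.
by rewrite (mulfI hn0 (mulfI hn0 E)).
Qed.

End Schwarz.

(** * Smoothness of inverse matrices; derivatives of sums of products *)

Section MatrixInverse.
Variables (R : realType) (V : normedModType R) (m : nat).

Lemma Ck_det k (U : set V) n (A : V -> 'M[R]_n) : open U ->
  (forall i j, Ck k U (fun x => A x i j : R^o)) ->
  Ck k U (fun x => \det (A x) : R^o).
Proof.
move=> oU AC; apply: Ck_sum => // s; apply: CkM => //; first exact: Ck_cst.
by apply: Ck_prod.
Qed.

(** Cramer's rule writes an entry of the inverse as a cofactor divided by the determinant. *)
Lemma Ck_invmx k (U : set V) (A : V -> 'M[R]_m) i j : open U ->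
  (forall i j, Ck k U (fun x => A x i j : R^o)) ->
  (forall x, U x -> A x \in unitmx) ->
  Ck k U (fun x => invmx (A x) i j : R^o).
Proof.
move=> oU AC Au.
apply: (@eq_Ck _ _ _ k U (fun x => (\det (A x))^-1 *
   ((-1) ^+ (j + i) * \det (row' j (col' i (A x)))) : R^o)) => //.
  by move=> x Ux; rewrite /invmx Au // !mxE.
apply: CkM => //; last first.
  apply: CkM => //; first exact: Ck_cst.
  apply: Ck_det => // i' j'; apply: eq_Ck (AC (lift j i') (lift i j')) => // x _.
  by rewrite !mxE.
apply: CkV => //; last exact: Ck_det.
by move=> x /Au; rewrite unitmxE unitfE.
Qed.

End MatrixInverse.

Section SmoothScalar.
Variables (R : realType) (V : normedModType R) (U : set V).
Implicit Types f g : V -> R^o.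

Lemma smooth_derive (W : normedModType R) (f : V -> W) v :
  smooth U f -> smooth U (fun x => 'D_v f x).
Proof. by move=> sf k; have [_] := sf k.+1; apply. Qed.

Lemma smooth_diff (W : normedModType R) (f : V -> W) x :
  smooth U f -> U x -> differentiable f x.
Proof. by move=> /(_ 1%N); exact: Ck_diff. Qed.

Lemma derive_sumM (I : finType) (f g : I -> V -> R^o) x v :
  (forall j, differentiable (f j) x) -> (forall j, differentiable (g j) x) ->
  'D_v (fun z => \sum_j f j z * g j z : R^o) x =
  \sum_j ('D_v (f j) x * g j x + f j x * 'D_v (g j) x).
Proof.
move=> fd gd.
have d (r : seq I) :
  is_derive x v (fun z => \sum_(j <- r) f j z * g j z : R^o)
    (\sum_(j <- r) ('D_v (f j) x * g j x + f j x * 'D_v (g j) x)).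
  elim: r => [|j r IH].
    rewrite big_nil; have -> : (fun z => \sum_(j <- [::]) f j z * g j z : R^o) = cst 0.
      by apply/funext => z; rewrite big_nil.
    exact: is_derive_cst.
  rewrite big_cons.
  have -> : (fun z => \sum_(j <- j :: r) f j z * g j z : R^o) =
            f j * g j + (fun z => \sum_(j <- r) f j z * g j z : R^o).
    by apply/funext => z; rewrite big_cons.
  apply: is_deriveD.
  apply: DeriveDef; first by apply: derivableM; exact: diff_derivable.
  rewrite deriveM; try exact: diff_derivable.
  by rewrite addrC; congr (_ + _); exact: mulrC.
by have := d (index_enum I) => -[].
Qed.

End SmoothScalar.

(** * Cartan spaces in induced coordinates *)

Section LocalCartanTheory.
Variables (R : realType) (n : nat).
Implicit Types (y X Y : 'rV[R]_(n + n)) (i j k : 'I_n).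

Definition fiber_scale (l : R) y : 'rV[R]_(n + n) :=
  row_mx (lsubmx y) (l *: rsubmx y).

(** What the local theory uses of a Cartan structure read in one induced chart. The image of such a
    chart is an open set that avoids [p = 0] and is a cone in [p], so that rescaling covectors stays
    inside it; [cartan_local] provides the instances. *)
Record local_cartan (U : set 'rV[R]_(n + n)) (L : 'rV[R]_(n + n) -> R) : Prop :=
  LocalCartan {
  lc_open : open U;
  lc_smooth : smooth U (L : _ -> R^o);
  lc_ge0 : forall y, U y -> 0 <= L y;
  lc_neq0 : forall y, U y -> rsubmx y != 0;
  lc_cone : forall l y, 0 < l -> U y -> U (fiber_scale l y);
  lc_hom : forall l y, 0 < l -> U y -> L (fiber_scale l y) = l * L y;
  lc_posdef : forall y, U y -> forall v : 'rV[R]_n, v != 0 ->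
    0 < \sum_i \sum_j g_up L y i j * v 0 i * v 0 j
}.

Lemma row_ddxp X : X = \sum_i X 0 (lshift n i) *: ddx R i +
                       \sum_i X 0 (rshift n i) *: ddp R i.
Proof. by rewrite {1}(row_sum_delta X) big_split_ord. Qed.

Lemma derive_ddxp (f : 'rV[R]_(n + n) -> R^o) y X : differentiable f y ->
  'D_X f y = \sum_i X 0 (lshift n i) * pdx i f y +
             \sum_i X 0 (rshift n i) * pdp i f y.
Proof. by move=> fd; rewrite derive_sumE // big_split_ord. Qed.

Lemma derive_coord y X k :
  'D_X (fun z : 'rV[R]_(n + n) => z 0 (rshift n k) : R^o) y = X 0 (rshift n k).
Proof.
by rewrite -(@derive_mxE _ _ _ (fun z : 'rV[R]_(n + n) => z)) // derive_id.
Qed.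

Lemma ddx_l i j : (ddx R i) 0 (lshift n j) = (i == j)%:R.
Proof. by rewrite mxE eq_lshift eq_sym. Qed.
Lemma ddx_r i j : (ddx R i) 0 (rshift n j) = 0.
Proof. by rewrite mxE eq_rlshift. Qed.
Lemma ddp_l i j : (ddp R i) 0 (lshift n j) = 0.
Proof. by rewrite mxE eq_lrshift. Qed.
Lemma ddp_r i j : (ddp R i) 0 (rshift n j) = (i == j)%:R.
Proof. by rewrite mxE eq_rshift eq_sym. Qed.

Lemma liouville_vE y : liouville_v y = row_mx 0 (rsubmx y).
Proof.
apply/rowP => k; rewrite /liouville_v summxE; case: (split_ordP k) => j ->.
  by rewrite row_mxEl mxE big1 // => i _; rewrite mxE ddp_l mulr0.
rewrite row_mxEr (bigD1 j) //= mxE ddp_r eqxx mulr1 big1 ?addr0 //.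
by move=> i ij; rewrite mxE ddp_r (negPf ij) mulr0.
Qed.

Lemma liouville_v_l y i : (liouville_v y) 0 (lshift n i) = 0.
Proof. by rewrite liouville_vE row_mxEl mxE. Qed.

Lemma liouville_v_r y i : (liouville_v y) 0 (rshift n i) = p_dn y 0 i.
Proof. by rewrite liouville_vE row_mxEr. Qed.

(** Scaling a covector moves along a straight line directed by C^*, which links homogeneity to a
    directional derivative. *)
Lemma fiber_scaleE l y : fiber_scale l y = y + (l - 1) *: liouville_v y.
Proof.
rewrite liouville_vE -[y in y + _]hsubmxK scale_row_mx add_row_mx scaler0 addr0.
by rewrite scalerBl scale1r addrC subrK.
Qed.

Section Fixed.
Variables (U : set 'rV[R]_(n + n)) (L : 'rV[R]_(n + n) -> R).
Hypothesis lc : local_cartan U L.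

Let oU := lc_open lc.
Let sL := lc_smooth lc.
Let Lo : 'rV[R]_(n + n) -> R^o := L.

Lemma L_diff y : U y -> differentiable Lo y.
Proof. exact: smooth_diff. Qed.

(** Euler's identity without a chain rule: moving by [h] along C^* is scaling by [1 + h], so the
    difference quotient equals [L y] exactly once [h] is nonzero and [1 + h] positive. *)
Lemma derive_liouville y : U y -> 'D_(liouville_v y) Lo y = L y.
Proof.
move=> Uy; rewrite /derive; apply: cvg_lim => //.
have : \forall h \near (0 : R)^',
    L y = h^-1 *: ((Lo \o shift y) (h *: liouville_v y) - Lo y).
  near=> h.
  have h1 : 0 < 1 + h.
    rewrite -ltrBlDl sub0r.
    near: h; apply: nbhs_dnbhs; apply: (@lt_nbhsr R); by rewrite ltrN10.
  have hn0 : h != 0 by near: h; exact: nbhs_dnbhs_neq.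
  have -> : (Lo \o shift y) (h *: liouville_v y) = (1 + h) * L y.
    by rewrite -(lc_hom lc h1 Uy) fiber_scaleE [1 + h]addrC addrK /= addrC.
  rewrite /Lo mulrDl mul1r addrC addKr -[RHS]/(h^-1 * (h * L y)).
  by rewrite mulKf.
move=> E; apply: cvg_trans; first exact: near_eq_cvg E.
exact: cvg_cst.
Unshelve. all: by end_near. Qed.

Lemma euler y : U y -> \sum_i p_dn y 0 i * pdp i L y = L y.
Proof.
move=> Uy; rewrite -[RHS]derive_liouville // derive_ddxp; last exact: L_diff.
rewrite [X in _ = X + _]big1 ?add0r.
  by apply: eq_bigr => i _; rewrite liouville_v_r.
by move=> i _; rewrite liouville_v_l mul0r.
Qed.

Lemma derive_K2 y v : U y -> 'D_v (K2 L : _ -> R^o) y = 2 * (L y * 'D_v Lo y).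
Proof.
move=> Uy; have dL : derivable Lo y v by exact/diff_derivable/L_diff.
rewrite -[K2 L]/(Lo ^+ 2) expr2 deriveM //.
by rewrite mulr_natl mulr2n.
Qed.

Lemma p_upE y i : U y -> p_up L y i = L y * pdp i L y.
Proof. by move=> Uy; rewrite /p_up /pdp derive_K2 // mulKf ?pnatr_eq0. Qed.

Lemma p_up_smooth i : smooth U (fun y => p_up L y i : R^o).
Proof.
move=> k; apply: (@eq_Ck _ _ _ k U (fun y => L y * pdp i L y : R^o)) => //.
  by move=> y Uy; rewrite p_upE.
by apply: CkM => //; exact: (smooth_derive (ddp R i) sL).
Qed.

Lemma K2_smooth : smooth U (K2 L : _ -> R^o).
Proof. by move=> k; apply: eq_Ck (CkM oU (sL k) (sL k)). Qed.

Lemma p_upM y : U y -> \sum_i p_dn y 0 i * p_up L y i = L y ^+ 2.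
Proof.
move=> Uy; under eq_bigr => i _ do rewrite p_upE // mulrCA.
by rewrite -mulr_sumr euler.
Qed.

Lemma g_upE y i j : U y -> g_up L y i j = 'D_(ddp R i) (fun z => p_up L z j : R^o) y.
Proof.
move=> Uy; rewrite /g_up [LHS]mxE.
have -> : (fun z => p_up L z j : R^o) = 2^-1 *: (pdp j (K2 L) : _ -> R^o).
  by apply/funext => z.
rewrite deriveZ //; apply: diff_derivable.
exact: (smooth_diff (smooth_derive (ddp R j) K2_smooth)).
Qed.

Lemma g_up_sym y i j : U y -> g_up L y i j = g_up L y j i.
Proof.
move=> Uy; rewrite /g_up [LHS]mxE [RHS]mxE /pdp.
by rewrite (derive_comm (ddp R j) (ddp R i) oU (K2_smooth 2) Uy).
Qed.

(** Differentiating [p_j p^j = K^2] along [d/dp_i] gives [p^i + g^ij p_j = 2 p^i]. *)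
Lemma g_up_p y i : U y -> \sum_j g_up L y i j * p_dn y 0 j = p_up L y i.
Proof.
move=> Uy.
have dd j : differentiable (fun z : 'rV[R]_(n + n) => z 0 (rshift n j) : R^o) y.
  exact: differentiable_coord.
have dp j : differentiable (fun z => p_up L z j : R^o) y.
  exact: (smooth_diff (p_up_smooth j)).
have := derive_sumM (ddp R i) dd dp.
have -> : 'D_(ddp R i) (fun z : 'rV[R]_(n + n) =>
            \sum_j z 0 (rshift n j) * p_up L z j : R^o) y =
          'D_(ddp R i) (K2 L : _ -> R^o) y.
  apply: (eq_derive_open _ oU) => // z Uz.
  rewrite /K2 -p_upM //.
  by apply: eq_bigr => j _; rewrite mxE.
rewrite big_split /= (bigD1 i) //= derive_coord ddp_r eqxx mul1r big1 ?addr0;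
  last first.
  by move=> j ji; rewrite derive_coord ddp_r eq_sym (negPf ji) mul0r.
have -> : 'D_(ddp R i) (K2 L : _ -> R^o) y = 2 * p_up L y i.
  by rewrite /p_up mulVKf ?pnatr_eq0.
rewrite mulr_natl mulr2n => /addrI ->.
by apply: eq_bigr => j _; rewrite g_upE // mxE mulrC.
Qed.

(** Since [g^ij p_i p_j = K^2], definiteness evaluated at the nonzero covector [p] itself excludes
    [K = 0]. *)
Lemma L_gt0 y : U y -> 0 < L y.
Proof.
move=> Uy; rewrite lt_neqAle (lc_ge0 lc Uy) andbT eq_sym.
have := lc_posdef lc Uy (lc_neq0 lc Uy).
have -> : \sum_i \sum_j g_up L y i j * (rsubmx y) 0 i * (rsubmx y) 0 j = L y ^+ 2.
  rewrite -p_upM //; apply: eq_bigr => i _; rewrite -g_up_p // mulr_sumr.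
  by apply: eq_bigr => j _; rewrite mulrCA mulrA.
by move=> L2; apply/eqP => L0; rewrite L0 expr0n ltxx in L2.
Qed.

Lemma g_up_unit y : U y -> g_up L y \in unitmx.
Proof.
move=> Uy; rewrite unitmxE unitfE; apply/det0P => -[v v0 vg].
have := lc_posdef lc Uy v0; rewrite exchange_big big1 ?ltxx //= => j _.
rewrite -mulr_suml; have /matrixP/(_ 0 j) := vg; rewrite !mxE => vgj.
suff -> : \sum_i g_up L y i j * v 0 i = 0 by rewrite mul0r.
by rewrite -[RHS]vgj; apply: eq_bigr => i _; rewrite mulrC.
Qed.

Lemma g_up_smooth i j : smooth U (fun y => g_up L y i j : R^o).
Proof.
move=> k.
apply: (eq_Ck _ _ (@smooth_derive _ _ _ _ _ (ddp R i) (p_up_smooth j) k)) => //.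
by move=> y Uy; rewrite g_upE.
Qed.

Lemma g_dn_smooth i j : smooth U (fun y => g_dn L y i j : R^o).
Proof.
move=> k; apply: Ck_invmx => //; first by move=> i' j'; exact: g_up_smooth.
by move=> y; exact: g_up_unit.
Qed.

Lemma g_dn_up y i k : U y ->
  \sum_j g_dn L y i j * g_up L y j k = (i == k)%:R.
Proof.
by move=> Uy; have /matrixP/(_ i k) := mulVmx (g_up_unit Uy); rewrite !mxE.
Qed.

Lemma g_dn_sym y i j : U y -> g_dn L y i j = g_dn L y j i.
Proof.
move=> Uy; suff /matrixP/(_ j i) : (g_dn L y)^T = g_dn L y by rewrite mxE.
rewrite /g_dn trmx_inv; congr invmx.
by apply/matrixP => a b; rewrite [LHS]mxE; exact: g_up_sym.
Qed.

Lemma g_dn_p y i : U y -> \sum_j g_dn L y i j * p_up L y j = p_dn y 0 i.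
Proof.
move=> Uy; under eq_bigr => j _ do rewrite -g_up_p // mulr_sumr.
rewrite exchange_big /= (bigD1 i) //= [X in _ + X]big1 ?addr0.
  under eq_bigr => j _ do rewrite mulrA.
  by rewrite -mulr_suml g_dn_up // eqxx mul1r.
move=> k ki; under eq_bigr => j _ do rewrite mulrA.
by rewrite -mulr_suml g_dn_up // eq_sym (negPf ki) mul0r.
Qed.

Lemma g_dn_diff y i j : U y -> differentiable (fun y => g_dn L y i j : R^o) y.
Proof. exact: (smooth_diff (g_dn_smooth i j)). Qed.

Lemma p_up_diff y i : U y -> differentiable (fun y => p_up L y i : R^o) y.
Proof. exact: (smooth_diff (p_up_smooth i)). Qed.

(** Derivative along [v] of [g_ij p^j = p_i]. Taken along [d/dp_h] it removes the correction term of
    the connection; taken along [d/dx^i] it trades derivatives of [g_ij] for derivatives of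
    [p^j]. *)
Lemma derive_g_dn_p y i v : U y ->
  \sum_j 'D_v (fun z => g_dn L z i j : R^o) y * p_up L y j +
  \sum_j g_dn L y i j * 'D_v (fun z => p_up L z j : R^o) y = v 0 (rshift n i).
Proof.
move=> Uy; rewrite -(derive_coord y).
rewrite -big_split /= -derive_sumM; last 2 first.
- by move=> j; exact: g_dn_diff.
- by move=> j; exact: p_up_diff.
apply: (eq_derive_open _ oU) => // z Uz.
by rewrite g_dn_p // mxE.
Qed.

(* Differentiate [g_ij p^j = p_i] along [d/dp_h] and use [dp^j/dp_h = g^hj]. *)
Lemma pdp_g_dn_p y i h : U y ->
  \sum_j pdp h (fun z => g_dn L z i j) y * p_up L y j = 0.
Proof.
move=> Uy; have := derive_g_dn_p i (ddp R h) Uy.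
have -> : \sum_j g_dn L y i j * 'D_(ddp R h) (fun z => p_up L z j : R^o) y =
          (i == h)%:R.
  rewrite -(g_dn_up i h Uy); apply: eq_bigr => j _.
  by rewrite -g_upE // g_up_sym.
by rewrite ddp_r eq_sym => /(canRL (addrK _)); rewrite subrr.
Qed.

(** Contracting with [p_i] replaces [g^is] by [p^s]. *)
Lemma gamma0E y j k : U y -> gamma0 L y j k =
  2^-1 * \sum_s p_up L y s *
    (pdx k (fun z => g_dn L z j s) y + pdx j (fun z => g_dn L z s k) y
     - pdx s (fun z => g_dn L z j k) y).
Proof.
move=> Uy; rewrite /gamma0 /gamma.
under eq_bigr => i _ do rewrite -mulrA mulr_suml.
rewrite -mulr_sumr exchange_big /=; congr (_ * _); apply: eq_bigr => s _.
rewrite -(g_up_p s Uy) mulr_suml; apply: eq_bigr => i _.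
by rewrite g_up_sym // mulrAC.
Qed.

(** The [x]-derivative of [g_sk p^k = p_s] vanishes, so the left-hand side is
    [- p^s g_sk dp^k/dx^i = - p_k dp^k/dx^i]. As [p_k p^k = K^2], this is minus the [x^i]-derivative
    of [K^2]. *)
Lemma pdx_g_dn_p y i : U y ->
  \sum_s p_up L y s * (\sum_k p_up L y k * pdx i (fun z => g_dn L z s k) y) =
  - (2 * (L y * pdx i L y)).
Proof.
move=> Uy.
have dd j : differentiable (fun z : 'rV[R]_(n + n) => z 0 (rshift n j) : R^o) y.
  exact: differentiable_coord.
have dp j : differentiable (fun z => p_up L z j : R^o) y.
  exact: (smooth_diff (p_up_smooth j)).
have := derive_sumM (ddx R i) dd dp.
have -> : 'D_(ddx R i) (fun z : 'rV[R]_(n + n) =>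
            \sum_j z 0 (rshift n j) * p_up L z j : R^o) y =
          'D_(ddx R i) (K2 L : _ -> R^o) y.
  apply: (eq_derive_open _ oU) => // z Uz.
  rewrite /K2 -p_upM //.
  by apply: eq_bigr => j _; rewrite mxE.
rewrite derive_K2 // => ->.
under [in RHS]eq_bigr => j _ do rewrite derive_coord ddx_r mul0r add0r.
transitivity (- \sum_s p_up L y s *
    \sum_k g_dn L y s k * 'D_(ddx R i) (fun z => p_up L z k : R^o) y).
  rewrite -sumrN; apply: eq_bigr => s _; rewrite -mulrN; congr (_ * _).
  have := derive_g_dn_p s (ddx R i) Uy; rewrite ddx_r => /eqP.
  rewrite addr_eq0 => /eqP <-; apply: eq_bigr => k _; exact: mulrC.
congr (- _).
transitivity (\sum_s \sum_k p_up L y s * (g_dn L y s k *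
    'D_(ddx R i) (fun z => p_up L z k : R^o) y)).
  by apply: eq_bigr => s _; rewrite mulr_sumr.
rewrite exchange_big /=; apply: eq_bigr => k _.
have -> : y 0 (rshift n k) = p_dn y 0 k by rewrite mxE.
rewrite -g_dn_p // mulr_suml; apply: eq_bigr => s _.
by rewrite g_dn_sym // mulrCA mulrA.
Qed.

(* This is [delta K / delta x^i = 0], multiplied by [K]. *)
Lemma Ncoef_p y i : U y ->
  \sum_j Ncoef L y i j * p_up L y j = - (L y * pdx i L y).
Proof.
move=> Uy; rewrite /Ncoef; under eq_bigr => j _ do rewrite mulrBl.
rewrite sumrB [X in _ - X](_ : _ = 0) ?subr0; last first.
  under eq_bigr => j _ do rewrite -mulrA mulr_suml.
  rewrite -mulr_sumr exchange_big /= big1 ?mulr0 // => h _.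
  under eq_bigr => j _ do rewrite -mulrA.
  by rewrite -mulr_sumr pdp_g_dn_p // mulr0.
under eq_bigr => k _ do rewrite gamma0E // -mulrA.
rewrite -mulr_sumr; apply: (@mulfI _ 2); first by rewrite pnatr_eq0.
rewrite mulVKf ?pnatr_eq0 // mulrN -pdx_g_dn_p //.
under eq_bigr => k _ do rewrite mulr_suml.
(* The three Christoffel terms become [A k s + B k s - A s k]. The two [A] terms cancel after
   exchanging the sums, and the sum of [B] is known from [pdx_g_dn_p]. *)
set A := fun k s => p_up L y s * pdx k (fun z => g_dn L z i s) y * p_up L y k.
set B := fun k s => p_up L y s * (p_up L y k * pdx i (fun z => g_dn L z s k) y).
transitivity (\sum_k \sum_s (A k s + B k s - A s k)).
  apply: eq_bigr => k _; apply: eq_bigr => s _; rewrite /A /B.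
  move: (p_up L y s) (p_up L y k) (pdx _ _ _) (pdx _ _ _) (pdx _ _ _) => a b c d e.
  ring.
under eq_bigr => k _ do rewrite sumrB big_split /=.
rewrite sumrB big_split /= [X in _ - X]exchange_big /= addrAC subrr add0r.
rewrite exchange_big /=; apply: eq_bigr => s _.
by rewrite mulr_sumr.
Qed.

(** The [p]-components of xi^* are [N_ji p^j], contracted on the first index, whereas [Ncoef_p]
    contracts the second; symmetry reconciles them in [liouville_hE]. *)
Lemma Ncoef_sym y i j : U y -> Ncoef L y i j = Ncoef L y j i.
Proof.
move=> Uy.
have pdsym (v : 'rV[R]_(n + n)) a b : 'D_v (fun z => g_dn L z a b : R^o) y =
    'D_v (fun z => g_dn L z b a : R^o) y.
  by apply: (eq_derive_open _ oU) => // z Uz; exact: g_dn_sym.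
have pdxsym k a b : pdx k (fun z => g_dn L z a b) y = pdx k (fun z => g_dn L z b a) y.
  exact: pdsym.
have pdpsym k a b : pdp k (fun z => g_dn L z a b) y = pdp k (fun z => g_dn L z b a) y.
  exact: pdsym.
have E1 : gamma0 L y i j = gamma0 L y j i.
  rewrite (gamma0E i j Uy) (gamma0E j i Uy).
  apply: (congr1 ( *%R 2^-1)); apply: eq_bigr => s _.
  rewrite (pdxsym j i s) (pdxsym i s j) (pdxsym s i j).
  by rewrite [pdx j _ y + _]addrC.
rewrite /Ncoef E1; apply: (congr1 (fun t => gamma0 L y j i - 2^-1 * t)).
by apply: eq_bigr => h _; rewrite (pdpsym h i j).
Qed.

End Fixed.
End LocalCartanTheory.

Lemma span_enumP (R : realType) (vT : vectType R) k (F : 'I_k -> vT) X :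
  X \in <<[seq F i | i <- enum 'I_k]>>%VS <->
  exists c : 'I_k -> R, X = \sum_i c i *: F i.
Proof.
rewrite span_def big_map big_enum; split.
  move=> /memv_sumP[vs vsP ->].
  have /fin_all_exists[c cP] i : exists a, vs i = a *: F i.
    by have /vlineP[a ->] := vsP i isT; exists a.
  by exists c; apply: eq_bigr => i _.
move=> [c ->]; apply: memv_sumr => i _.
by rewrite memvZ ?memv_line.
Qed.

(** * Linear algebra in the adapted frame *)

Section AdaptedFrame.
Variables (R : realType) (n : nat).
Implicit Types (y X Y : 'rV[R]_(n + n)) (i j k : 'I_n).

Definition liouville_form y X : R := \sum_i p_dn y 0 i * X 0 (lshift n i).

(* The Hamiltonian field (dH/dp, - dH/dx) of H = L^2/2. *)
Definition hamilton_field (L : 'rV[R]_(n + n) -> R) y : 'rV[R]_(n + n) :=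
  row_mx (\row_i p_up L y i) (\row_i - (L y * pdx i L y)).

Lemma dx_lin i a X Y : dx i (a *: X + Y) = a * dx i X + dx i Y.
Proof. by rewrite /dx !mxE. Qed.

Lemma dx_sum i (I : finType) (c : I -> R) (F : I -> 'rV[R]_(n + n)) :
  dx i (\sum_j c j *: F j) = \sum_j c j * dx i (F j).
Proof. by rewrite /dx summxE; apply: eq_bigr => j _; rewrite mxE. Qed.

Section Form.
Variable y : 'rV[R]_(n + n).

Lemma liouville_form_lin a X Y :
  liouville_form y (a *: X + Y) = a * liouville_form y X + liouville_form y Y.
Proof.
rewrite /liouville_form mulr_sumr -big_split; apply: eq_bigr => i _ /=.
by rewrite !mxE mulrDr mulrCA.
Qed.

Lemma liouville_formD X Y :
  liouville_form y (X + Y) = liouville_form y X + liouville_form y Y.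
Proof. by have := liouville_form_lin 1 X Y; rewrite scale1r mul1r. Qed.

Lemma liouville_form0 : liouville_form y 0 = 0.
Proof. by rewrite /liouville_form big1 // => i _; rewrite [X in _ * X]mxE mulr0. Qed.

Lemma liouville_formZ a X : liouville_form y (a *: X) = a * liouville_form y X.
Proof. by rewrite -[a *: X]addr0 liouville_form_lin liouville_form0 addr0. Qed.

Lemma liouville_form_sum (I : finType) (c : I -> R) (F : I -> 'rV[R]_(n + n)) :
  liouville_form y (\sum_j c j *: F j) = \sum_j c j * liouville_form y (F j).
Proof.
apply: (big_ind2 (fun a b => liouville_form y a = b)).
- exact: liouville_form0.
- by move=> a b a' b' <- <-; rewrite liouville_formD.
- by move=> i _; rewrite liouville_formZ.
Qed.
End Form.

Section Coframe.
Variables (L : 'rV[R]_(n + n) -> R) (y : 'rV[R]_(n + n)).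

Lemma deltap_lin i a X Y :
  deltap L y i (a *: X + Y) = a * deltap L y i X + deltap L y i Y.
Proof.
rewrite /deltap !mxE mulrBr addrACA -opprD; congr (_ - _).
rewrite mulr_sumr -big_split; apply: eq_bigr => j _ /=.
by rewrite dx_lin mulrDr mulrCA.
Qed.

Lemma deltapD i X Y : deltap L y i (X + Y) = deltap L y i X + deltap L y i Y.
Proof. by have := deltap_lin i 1 X Y; rewrite scale1r mul1r. Qed.

Lemma deltap0 i : deltap L y i 0 = 0.
Proof.
by rewrite /deltap mxE big1 ?subr0 // => j _; rewrite /dx [X in _ * X]mxE mulr0.
Qed.

Lemma deltapZ i a X : deltap L y i (a *: X) = a * deltap L y i X.
Proof. by rewrite -[a *: X]addr0 deltap_lin deltap0 addr0. Qed.

Lemma deltap_sum i (I : finType) (c : I -> R) (F : I -> 'rV[R]_(n + n)) :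
  deltap L y i (\sum_j c j *: F j) = \sum_j c j * deltap L y i (F j).
Proof.
apply: (big_ind2 (fun a b => deltap L y i a = b)).
- exact: deltap0.
- by move=> a b a' b' <- <-; rewrite deltapD.
- by move=> j _; rewrite deltapZ.
Qed.

Lemma dx_ddp i j : dx i (ddp R j) = 0. Proof. exact: ddp_l. Qed.

Lemma sum_delta (F : 'I_n -> R) i : \sum_j F j * (j == i)%:R = F i.
Proof.
rewrite (bigD1 i) //= eqxx mulr1 big1 ?addr0 // => j ji.
by rewrite (negPf ji) mulr0.
Qed.

Lemma deltap_ddp i j : deltap L y i (ddp R j) = (j == i)%:R.
Proof.
by rewrite /deltap ddp_r big1 ?subr0 // => k _; rewrite dx_ddp mulr0.
Qed.

Lemma dx_deltax i j : dx i (deltax L y j) = (j == i)%:R.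
Proof.
rewrite /dx mxE ddx_l summxE big1 ?addr0 // => k _.
by rewrite mxE ddp_l mulr0.
Qed.

Lemma deltax_r i j : deltax L y j 0 (rshift n i) = Ncoef L y j i.
Proof.
rewrite mxE ddx_r add0r summxE -[RHS]sum_delta.
by apply: eq_bigr => k _; rewrite mxE ddp_r.
Qed.

Lemma deltap_deltax i j : deltap L y i (deltax L y j) = 0.
Proof.
rewrite /deltap deltax_r; under eq_bigr => k _ do rewrite dx_deltax eq_sym.
by rewrite sum_delta subrr.
Qed.

Lemma rshiftE i X :
  X 0 (rshift n i) = deltap L y i X + \sum_j Ncoef L y j i * dx j X.
Proof. by rewrite /deltap subrK. Qed.

Lemma adapted_ext X Y : (forall i, dx i X = dx i Y) ->
  (forall i, deltap L y i X = deltap L y i Y) -> X = Y.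
Proof.
move=> dXY pXY; apply/rowP => k; case: (split_ordP k) => i ->; first exact: dXY.
rewrite !rshiftE pXY; congr (_ + _).
by apply: eq_bigr => j _; rewrite dXY.
Qed.

(** Together with [deltap_acs] this gives the block form of [J] in the adapted coframe, from which
    every later property of [J] is read. *)
Lemma dx_acs k X : dx k (acs L y X) = \sum_i deltap L y i X * g_up L y i k.
Proof.
rewrite /acs -[X in dx k (X + _)]scale1r dx_lin mul1r !dx_sum big1 ?add0r.
  apply: eq_bigr => i _; rewrite dx_sum; congr (_ * _).
  by under eq_bigr => j _ do rewrite dx_deltax; rewrite sum_delta.
move=> i _; rewrite -scaleN1r -[_ *: _]addr0 dx_lin dx_sum big1 => [|j _].
  by rewrite mulr0 add0r /dx mxE mulr0.
by rewrite dx_ddp mulr0.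
Qed.

Lemma deltap_acs k X :
  deltap L y k (acs L y X) = - \sum_i dx i X * g_dn L y i k.
Proof.
rewrite /acs deltapD !deltap_sum [X in _ + X]big1 ?addr0 => [|i _].
  rewrite -sumrN; apply: eq_bigr => i _.
  rewrite -scaleN1r deltapZ deltap_sum mulN1r mulrN; congr (- (_ * _)).
  by under eq_bigr => j _ do rewrite deltap_ddp; rewrite sum_delta.
rewrite deltap_sum big1 ?mulr0 // => j _.
by rewrite deltap_deltax mulr0.
Qed.

Lemma dx_liouville_v i : dx i (liouville_v y) = 0.
Proof. exact: liouville_v_l. Qed.

Lemma deltap_liouville_v i : deltap L y i (liouville_v y) = p_dn y 0 i.
Proof.
rewrite /deltap liouville_v_r big1 ?subr0 // => j _.
by rewrite dx_liouville_v mulr0.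
Qed.

Lemma memv_vertical X : X \in vertical R n <-> forall i, dx i X = 0.
Proof.
rewrite /vertical span_enumP; split=> [[c ->] i|X0].
  by rewrite dx_sum big1 // => j _; rewrite dx_ddp mulr0.
exists (fun i => X 0 (rshift n i)).
rewrite {1}(row_ddxp X) big1 ?add0r // => i _.
by rewrite -/(dx i X) X0 scale0r.
Qed.

End Coframe.

Section Local.
Variables (U : set 'rV[R]_(n + n)) (L : 'rV[R]_(n + n) -> R).
Hypothesis lc : local_cartan U L.
Variable y : 'rV[R]_(n + n).
Hypothesis Uy : U y.

Local Notation theta := (liouville_form y).
Let dL X : R := 'D_X (L : _ -> R^o) y.

Let L0 : L y != 0. Proof. by rewrite gt_eqF // (L_gt0 lc). Qed.

Lemma dLD X Y : dL (X + Y) = dL X + dL Y.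
Proof. by rewrite /dL !deriveE ?linearD //; exact: (L_diff lc). Qed.

Lemma dLZ a X : dL (a *: X) = a * dL X.
Proof. by rewrite /dL !deriveE ?linearZ //; exact: (L_diff lc). Qed.

(** Expand [K dK] in the adapted coframe: the coefficient of [dx^j] is [K dK/dx^j + N_ji p^i], which
    [Ncoef_p] makes zero. Thus [dK] sees only the vertical part of a vector. *)
Lemma dL_deltap X : L y * dL X = \sum_i deltap L y i X * p_up L y i.
Proof.
rewrite /dL derive_ddxp; last exact: (L_diff lc).
under [RHS]eq_bigr => i _ do rewrite mulrBl.
rewrite sumrB mulrDr addrC; congr (_ + _).
  by rewrite mulr_sumr; apply: eq_bigr => i _; rewrite (p_upE lc) // mulrCA.
under [in RHS]eq_bigr => i _ do rewrite mulr_suml.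
rewrite exchange_big /= mulr_sumr -sumrN; apply: eq_bigr => j _.
rewrite -[X in - X](_ : dx j X * \sum_i Ncoef L y j i * p_up L y i = _).
  by rewrite (Ncoef_p lc) // mulrN opprK mulrCA.
by rewrite mulr_sumr; apply: eq_bigr => i _; rewrite mulrAC mulrC.
Qed.

Lemma dL_eq0 X : dL X = 0 <-> \sum_i deltap L y i X * p_up L y i = 0.
Proof.
rewrite -dL_deltap; split=> [->|/eqP]; first by rewrite mulr0.
by rewrite mulf_eq0 (negPf L0) /= => /eqP.
Qed.

Lemma dL_liouville_v : dL (liouville_v y) = L y.
Proof. exact: (derive_liouville lc). Qed.

Lemma theta_liouville_v : theta (liouville_v y) = 0.
Proof.
by rewrite /liouville_form big1 // => i _; rewrite liouville_v_l mulr0.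
Qed.

Lemma dx_liouville_h i : dx i (liouville_h L y) = p_up L y i.
Proof.
rewrite /liouville_h dx_acs -(g_up_p lc) //; apply: eq_bigr => j _.
by rewrite deltap_liouville_v mulrC (g_up_sym lc).
Qed.

Lemma deltap_liouville_h i : deltap L y i (liouville_h L y) = 0.
Proof.
rewrite /liouville_h deltap_acs big1 ?oppr0 // => j _.
by rewrite dx_liouville_v mul0r.
Qed.

(** The [p]-components [N_ij p^j] reduce to [- K dK/dx^i] because [delta K / delta x^i = 0]; no
    connection coefficient is left. *)
Lemma liouville_hE : liouville_h L y = hamilton_field L y.
Proof.
apply/rowP => k; case: (split_ordP k) => i ->.
  by rewrite row_mxEl mxE -/(dx i _) dx_liouville_h.
rewrite (rshiftE L y) deltap_liouville_h add0r row_mxEr mxE -(Ncoef_p lc) //.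
by apply: eq_bigr => j _; rewrite dx_liouville_h (Ncoef_sym lc).
Qed.

Lemma dL_liouville_h : dL (liouville_h L y) = 0.
Proof.
by apply/dL_eq0; rewrite big1 // => i _; rewrite deltap_liouville_h mul0r.
Qed.

Lemma theta_liouville_h : theta (liouville_h L y) = L y ^+ 2.
Proof.
rewrite -(p_upM lc) //; apply: eq_bigr => i _.
by rewrite -/(dx i _) dx_liouville_h.
Qed.

Lemma metric_liouville_v X : metric L y (liouville_v y) X = L y * dL X.
Proof.
rewrite dL_deltap /metric [X in X + _]big1 ?add0r => [|i _]; last first.
  by rewrite big1 // => j _; rewrite dx_liouville_v mulr0 mul0r.
rewrite exchange_big; apply: eq_bigr => j _ /=.
rewrite -mulr_suml mulrC -(g_up_p lc) //; congr (_ * _).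
by apply: eq_bigr => i _; rewrite deltap_liouville_v (g_up_sym lc).
Qed.

Lemma metric_liouville_h X : metric L y X (liouville_h L y) = theta X.
Proof.
rewrite /metric [X in _ + X]big1 ?addr0 => [|i _]; last first.
  by rewrite big1 // => j _; rewrite deltap_liouville_h mulr0.
apply: eq_bigr => i _; rewrite -(g_dn_p lc) // mulr_suml.
by apply: eq_bigr => j _; rewrite dx_liouville_h mulrAC.
Qed.

Lemma memv_V_C X : X \in V_C L y <-> (forall i, dx i X = 0) /\ dL X = 0.
Proof.
rewrite memV_C metric_liouville_v mulf_eq0 (negPf L0) /=; split.
  by move=> /andP[/memv_vertical ? /eqP].
by move=> [/memv_vertical -> ->] /=.
Qed.

Lemma deltap_barp i j : deltap L y j (barp L y i) =
  (i == j)%:R - p_up L y i / K2 L y * p_dn y 0 j.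
Proof.
by rewrite /barp deltapD deltap_ddp -scaleNr deltapZ deltap_liouville_v mulNr.
Qed.

Lemma dx_barx i k : dx k (barx L y i) =
  g_up L y i k - p_up L y i / K2 L y * p_up L y k.
Proof.
rewrite /barx dx_acs; under eq_bigr => j _ do rewrite deltap_barp mulrBl.
rewrite sumrB; congr (_ - _).
  by under eq_bigr => j _ do rewrite mulrC eq_sym; rewrite sum_delta.
rewrite -(g_up_p lc k Uy) mulr_sumr; apply: eq_bigr => j _.
by rewrite (g_up_sym lc j k Uy) mulrAC mulrA.
Qed.

Lemma deltap_barx i k : deltap L y k (barx L y i) = 0.
Proof.
rewrite /barx deltap_acs big1 ?oppr0 // => j _.
rewrite /barp addrC -scaleNr dx_lin dx_liouville_v dx_ddp.
by rewrite mulr0 addr0 mul0r.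
Qed.

Lemma theta_barx i : theta (barx L y i) = 0.
Proof.
rewrite /liouville_form.
under eq_bigr => k _ do rewrite -/(dx k _) dx_barx mulrBr.
rewrite sumrB; under eq_bigr => k _ do rewrite mulrC.
rewrite (g_up_p lc) //.
under eq_bigr => k _ do rewrite mulrCA.
by rewrite -mulr_sumr (p_upM lc) // /K2 divfK ?subrr // expf_neq0.
Qed.

Lemma memv_H_xi X : X \in H_xi L y <->
  (forall i, deltap L y i X = 0) /\ theta X = 0.
Proof.
rewrite /H_xi span_enumP; split=> [[c ->]|[X0 tX]].
  split=> [i|]; rewrite ?deltap_sum ?liouville_form_sum big1 // => j _.
    by rewrite deltap_barx mulr0.
  by rewrite theta_barx mulr0.
(* The coefficients are the components of [X] with the index lowered: [w_i g^ik] returns [dx^k(X)],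
   and [w_i p^i = theta(X) = 0] kills the correction term of [barx]. *)
pose w i := \sum_k g_dn L y i k * dx k X.
exists w; apply: (@adapted_ext L y) => k; last first.
  by rewrite X0 deltap_sum big1 // => j _; rewrite deltap_barx mulr0.
rewrite dx_sum; under eq_bigr => i _ do
  rewrite dx_barx mulrBr (mulrA (w i) _ (p_up L y k)) (mulrA (w i) (p_up L y i)).
rewrite sumrB -!mulr_suml.
have -> : \sum_i w i * p_up L y i = 0.
  rewrite -[RHS]tX /w /liouville_form.
  under eq_bigr => i _ do rewrite mulr_suml.
  rewrite exchange_big; apply: eq_bigr => i _ /=.
  rewrite -(g_dn_p lc) // mulr_suml; apply: eq_bigr => j _.
  by rewrite (g_dn_sym lc) // mulrAC.
rewrite !mul0r subr0 /w; under eq_bigr => i _ do rewrite mulr_suml.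
rewrite exchange_big /= -[LHS](sum_delta (fun j => dx j X)); apply: eq_bigr => j _ /=.
rewrite -(g_dn_up lc j k Uy). rewrite mulr_sumr; apply: eq_bigr => i _.
by rewrite (g_dn_sym lc i j Uy) mulrA [dx j X * _]mulrC.
Qed.

Local Notation D := (H_xi L y + V_C L y)%VS.
Local Notation D' := <[liouville_h L y]>%VS.

(** In the adapted frame [dK] depends only on the vertical part of a vector and [theta] only on its
    horizontal part, so the two equations cut out the two summands independently. *)
Lemma memv_D X : X \in D <-> dL X = 0 /\ theta X = 0.
Proof.
split.
  move=> /memv_addP[h /memv_H_xi[ph th] [v /memv_V_C[hv av] ->]].
  rewrite liouville_formD th add0r dLD av addr0; split.
    by apply/dL_eq0; rewrite big1 // => i _; rewrite ph mul0r.
  by rewrite /liouville_form big1 // => i _; rewrite -/(dx i v) hv mulr0.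
move=> [aX tX]; pose v := \sum_i deltap L y i X *: ddp R i.
have dv i : dx i v = 0 by rewrite dx_sum big1 // => j _; rewrite dx_ddp mulr0.
have pv i : deltap L y i v = deltap L y i X.
  by rewrite deltap_sum; under eq_bigr => j _ do rewrite deltap_ddp;
    rewrite sum_delta.
rewrite -[X](subrK v); apply: memv_add.
  apply/memv_H_xi; split=> [i|].
    by rewrite addrC -scaleN1r -[_ *: v]addr0 addrC deltapD addr0 deltapZ pv
      mulN1r subrr.
  rewrite liouville_formD tX add0r -scaleN1r liouville_formZ.
  rewrite /liouville_form big1 ?mulr0 // => i _.
  by rewrite -/(dx i v) dv mulr0.
apply/memv_V_C; split=> //; apply/dL_eq0; move/dL_eq0: aX => aX; rewrite -[RHS]aX.
by apply: eq_bigr => i _; rewrite pv.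
Qed.

Lemma directv_D : directv D.
Proof.
apply/directv_addP/vspaceP => X; rewrite memv_cap memv0; apply/andP/eqP.
  move=> [/memv_H_xi[ph _] /memv_V_C[hv _]].
  apply: (@adapted_ext L y) => i; first by rewrite hv /dx mxE.
  by rewrite ph deltap0.
by move=> ->; rewrite !mem0v.
Qed.

Lemma memv_D' X : X \in D' <-> exists a : R, X = a *: liouville_h L y.
Proof.
by split=> [/vlineP[k ->]|[k ->]]; [exists k | rewrite memvZ ?memv_line].
Qed.

Lemma capv_D_D' : (D :&: D' = 0)%VS.
Proof.
apply/vspaceP => X; rewrite memv_cap memv0; apply/andP/eqP.
  move=> [/memv_D[_ tX] /memv_D'[k XE]]; move/eqP: tX.
  rewrite XE liouville_formZ theta_liouville_h mulf_eq0 expf_eq0 (negPf L0) orbF.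
  by move=> /eqP ->; rewrite scale0r.
by move=> ->; rewrite !mem0v.
Qed.

Lemma memv_DD' X : X \in (D + D')%VS <-> dL X = 0.
Proof.
split.
  move=> /memv_addP[d /memv_D[ad _] [e /memv_D'[k ->] ->]].
  by rewrite dLD ad dLZ dL_liouville_h mulr0 addr0.
(* The coefficient is that of the projection onto xi^*, as [theta] takes the value [K^2] on xi^*;
   [dK] vanishes there, so the remainder stays in [ker dK]. *)
move=> aX; rewrite -(subrK ((theta X / L y ^+ 2) *: liouville_h L y) X).
apply: memv_add; last by apply/memv_D'; exists (theta X / L y ^+ 2).
apply/memv_D; rewrite -scaleNr dLD liouville_formD dLZ liouville_formZ.
rewrite aX dL_liouville_h mulr0 addr0 theta_liouville_h mulNr divfK ?subrr //.
by rewrite expf_neq0.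
Qed.

(** [J] exchanges the two equations of [D]: [K dK(J X) = - theta(X)] and [theta(J X) = K dK(X)]. *)
Lemma acs_D X : X \in D -> acs L y X \in D.
Proof.
move=> /memv_D[aX tX]; apply/memv_D; split.
  apply/dL_eq0; under eq_bigr => k _ do rewrite deltap_acs mulNr mulr_suml.
  rewrite sumrN exchange_big /= -[RHS]oppr0 -[X in _ = - X]tX; congr (- _).
  apply: eq_bigr => i _; rewrite -(g_dn_p lc i Uy) mulr_suml.
  by apply: eq_bigr => j _; rewrite -[LHS]mulrA [LHS]mulrC.
move/dL_eq0: aX => aX; rewrite -[RHS]aX /liouville_form.
under eq_bigr => k _ do rewrite -/(dx k _) dx_acs mulr_sumr.
rewrite exchange_big; apply: eq_bigr => i _ /=.
rewrite -(g_up_p lc i Uy) mulr_sumr.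
by apply: eq_bigr => j _; rewrite mulrC -mulrA.
Qed.

Lemma metric_D_D' X Y : X \in D -> Y \in D' -> metric L y X Y = 0.
Proof.
move=> /memv_D[_ tX] /memv_D'[k ->].
transitivity (k * metric L y X (liouville_h L y)); last first.
  by rewrite metric_liouville_h tX mulr0.
rewrite /metric mulrDr !mulr_sumr; congr (_ + _); apply: eq_bigr => i _;
  rewrite mulr_sumr; apply: eq_bigr => j _.
  by rewrite -[_ *: _]addr0 dx_lin [dx j 0]mxE addr0 mulrCA.
by rewrite deltapZ mulrCA.
Qed.

Lemma acs_liouville_h : acs L y (liouville_h L y) = - liouville_v y.
Proof.
rewrite -scaleN1r; apply: (@adapted_ext L y) => k.
  rewrite dx_acs -[_ *: _]addr0 dx_lin dx_liouville_v mulr0 [dx k 0]mxE addr0.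
  by rewrite big1 // => i _; rewrite deltap_liouville_h mul0r.
rewrite deltap_acs deltapZ deltap_liouville_v mulN1r -(g_dn_p lc k Uy).
congr (- _); apply: eq_bigr => i _.
by rewrite dx_liouville_h mulrC (g_dn_sym lc i k Uy).
Qed.

(** [J] sends xi^* to the opposite of C^*, and C^* is orthogonal to [ker dK]. *)
Lemma metric_acs_D' X Y : X \in D' -> dL Y = 0 -> metric L y (acs L y X) Y = 0.
Proof.
move=> /memv_D'[k ->] aY.
have -> : acs L y (k *: liouville_h L y) = (- k) *: liouville_v y.
  rewrite scaleNr -scalerN -acs_liouville_h; apply: (@adapted_ext L y) => i.
    rewrite -[X in _ = dx i X]addr0 dx_lin [dx i 0]mxE addr0 !dx_acs mulr_sumr.
    by apply: eq_bigr => j _; rewrite deltapZ mulrA.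
  rewrite deltapZ !deltap_acs mulrN mulr_sumr; congr (- _).
  apply: eq_bigr => j _.
  by rewrite -[_ *: _]addr0 dx_lin [dx j 0]mxE addr0 mulrA.
transitivity (- k * metric L y (liouville_v y) Y); last first.
  by rewrite metric_liouville_v aY !mulr0.
rewrite /metric mulrDr !mulr_sumr; congr (_ + _); apply: eq_bigr => i _;
  rewrite mulr_sumr; apply: eq_bigr => j _.
  rewrite -[_ *: _]addr0 dx_lin [dx i 0]mxE addr0 !mulrA; congr (_ * _ * _).
  exact: mulrC.
rewrite deltapZ !mulrA; congr (_ * _ * _); exact: mulrC.
Qed.

Lemma liouville_h_neq0 : liouville_h L y != 0.
Proof.
apply/eqP => xi0; move: theta_liouville_h; rewrite xi0 liouville_form0.
by move/esym/eqP; rewrite expf_eq0 (negPf L0).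
Qed.

Lemma dim_D' : \dim D' = 1%N.
Proof. by rewrite dim_vline liouville_h_neq0. Qed.

(** Adding the lines of xi^* and C^* to [D] fills the whole space: C^* is transverse to [ker dK]
    because [dK] takes the value [K] on it. Hence [dim D + 2 = n + n] and the subtraction is
    exact. *)
Lemma dim_D : \dim D = (n + n - 2)%N.
Proof.
have C0 : liouville_v y != 0.
  apply/eqP => C0; have := dL_liouville_v; rewrite C0 => E; case/eqP: L0.
  by rewrite -E -(scale0r (0 : 'rV[R]_(n + n))) dLZ mul0r.
have cap : ((D + D') :&: <[liouville_v y]> = 0)%VS.
  apply/vspaceP => X; rewrite memv_cap memv0; apply/andP/eqP.
    move=> [/memv_DD' aX /vlineP[k XE]]; move/eqP: aX.
    rewrite XE dLZ dL_liouville_v mulf_eq0 (negPf L0) orbF.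
    by move=> /eqP ->; rewrite scale0r.
  by move=> ->; rewrite !mem0v.
have full : ((D + D') + <[liouville_v y]> = fullv)%VS.
  apply/vspaceP => X; rewrite memvf.
  rewrite -(subrK ((dL X / L y) *: liouville_v y) X).
  apply: memv_add; last by rewrite memvZ ?memv_line.
  apply/memv_DD'; rewrite -scaleNr dLD dLZ dL_liouville_v.
  by rewrite mulNr divfK ?subrr.
have := congr1 (fun V : {vspace _} => \dim V) full.
rewrite /= dimvf dimv_disjoint_sum // dimv_disjoint_sum ?capv_D_D' //.
rewrite dim_D' dim_vline C0 /= -addnA => /(canRL (addnK _)) ->.
by rewrite -[X in _ = (X - _)%N]mul1n.
Qed.

End Local.

(* The coordinate frame projected onto D along C^* and xi^*.  Unlike [H_xi] and
   [V_C] it does not involve the connection coefficients. *)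
Definition frame_D (L : 'rV[R]_(n + n) -> R) (a : 'I_(n + n)) y : 'rV[R]_(n + n) :=
  delta_mx 0 a
  - ('D_(delta_mx 0 a) (L : _ -> R^o) y / L y) *: liouville_v y
  - (liouville_form y (delta_mx 0 a) / L y ^+ 2) *: hamilton_field L y.

Section FrameD.
Variables (U : set 'rV[R]_(n + n)) (L : 'rV[R]_(n + n) -> R).
Hypothesis lc : local_cartan U L.
Let oU := lc_open lc.
Let sL := lc_smooth lc.

(** The projection defining the frame is linear with image in [D]. On a vector of [D] the total
    corrections are multiples of [dK(X)] and [theta(X)], hence zero, so its coordinates are also its
    coefficients on the frame. *)
Lemma mem_frame_D y X : U y ->
  X \in <<[seq frame_D L a y | a <- enum 'I_(n + n)]>>%VS <->
  'D_X (L : _ -> R^o) y = 0 /\ liouville_form y X = 0.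
Proof.
move=> Uy; have L0 : L y != 0 by rewrite gt_eqF // (L_gt0 lc).
have xiE := liouville_hE lc Uy.
have memF a : frame_D L a y \in (H_xi L y + V_C L y)%VS.
  have gen (c1 c2 : R) (e : 'rV[R]_(n + n)) :
      'D_(e - c1 *: liouville_v y - c2 *: liouville_h L y) (L : _ -> R^o) y =
        'D_e (L : _ -> R^o) y - c1 * L y /\
      liouville_form y (e - c1 *: liouville_v y - c2 *: liouville_h L y) =
        liouville_form y e - c2 * L y ^+ 2.
    have sN (b : R) (v : 'rV[R]_(n + n)) : - (b *: v) = (- b) *: v.
      by rewrite scaleNr.
    rewrite !sN !(dLD lc Uy) !(dLZ lc Uy) !liouville_formD !liouville_formZ.
    rewrite (dL_liouville_v lc Uy) (dL_liouville_h lc Uy).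
    by rewrite theta_liouville_v (theta_liouville_h lc Uy) !mulr0 !addr0 !mulNr.
  apply/(memv_D lc Uy); rewrite /frame_D -xiE; have [-> ->] := gen
    ('D_(delta_mx 0 a) (L : _ -> R^o) y / L y)
    (liouville_form y (delta_mx 0 a) / L y ^+ 2) (delta_mx 0 a).
  by rewrite !divfK ?subrr // expf_neq0.
rewrite -(memv_D lc Uy); split.
  by move=> /span_enumP[c ->]; apply: memv_suml => a _; rewrite memvZ.
move=> /(memv_D lc Uy)[aX tX]; apply/span_enumP; exists (fun a => X 0 a).
rewrite /frame_D; under eq_bigr => a _ do rewrite !scalerBr !scalerA.
rewrite !sumrB -!scaler_suml -row_sum_delta.
have -> : \sum_a X 0 a * ('D_(delta_mx 0 a) (L : _ -> R^o) y / L y) = 0.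
  under eq_bigr => a _ do rewrite mulrA.
  rewrite -mulr_suml -derive_sumE ?aX ?mul0r //; exact: (L_diff lc).
have -> : \sum_a X 0 a * (liouville_form y (delta_mx 0 a) / L y ^+ 2) = 0.
  under eq_bigr => a _ do rewrite mulrA.
  by rewrite -mulr_suml -liouville_form_sum -row_sum_delta tX mul0r.
by rewrite !scale0r !subr0.
Qed.

Lemma coord_smooth a : smooth U (fun y => y 0 a : R^o).
Proof.
move=> k; apply: (@Ck_rVE _ _ k U _ (fun y : 'rV[R]_(n + n) => y)) => //.
by apply: (@Ck_linear _ _ _ k U idfun) => ?.
Qed.

Lemma liouville_v_smooth : smooth U (fun y : 'rV[R]_(n + n) => liouville_v y).
Proof.
move=> k; apply: Ck_rV => // b; case: (split_ordP b) => j ->.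
  by apply: eq_Ck (Ck_cst k U (0 : R^o)) => // y _; rewrite liouville_v_l.
apply: eq_Ck (@coord_smooth (rshift n j) k) => // y _.
by rewrite liouville_v_r mxE.
Qed.

Lemma hamilton_field_smooth : smooth U (hamilton_field L).
Proof.
move=> k; apply: Ck_rV => // b; case: (split_ordP b) => j ->.
  by apply: eq_Ck (p_up_smooth lc j k) => // y _; rewrite row_mxEl mxE.
apply: eq_Ck (CkN oU (CkM oU (sL k) (smooth_derive (ddx R j) sL k))) => // y _.
by rewrite row_mxEr mxE.
Qed.

Lemma CkZ (k m : nat) (f : 'rV[R]_(n + n) -> R^o) (g : 'rV[R]_(n + n) -> 'rV[R]_m) :
  Ck k U f -> Ck k U g -> Ck k U (fun y => f y *: g y).
Proof.
move=> fC gC; apply: Ck_rV => // i.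
apply: eq_Ck (CkM oU fC (Ck_rVE i oU gC)) => // y _.
by rewrite mxE.
Qed.

Lemma frame_D_smooth a : smooth U (frame_D L a).
Proof.
move=> k.
have VL : Ck k U (fun y => (L y)^-1 : R^o).
  by apply: CkV => // y Uy; rewrite gt_eqF // (L_gt0 lc).
have N1 := Ck_cst k U (-1 : R^o).
have tC : Ck k U (fun y => liouville_form y (delta_mx 0 a) : R^o).
  apply: Ck_sum => // i; apply: CkM => //; last exact: Ck_cst.
  apply: eq_Ck (@coord_smooth (rshift n i) k) => // y _.
  by rewrite /p_dn mxE.
have A1 := CkZ (CkM oU N1 (CkM oU (smooth_derive (delta_mx 0 a) sL k) VL))
  (liouville_v_smooth k).
have A2 := CkZ (CkM oU N1 (CkM oU tC (CkM oU VL VL))) (hamilton_field_smooth k).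
apply: eq_Ck (CkD oU (CkD oU (Ck_cst k U (delta_mx 0 a)) A1) A2) => // y _.
by rewrite /frame_D !mulN1r !scaleNr expr2 invfM.
Qed.

End FrameD.
End AdaptedFrame.

(** * Slice charts and curves of the indicatrix *)

Section LocalIndicatrix.
Variables (R : realType) (n : nat).
Variables (U : set 'rV[R]_(n + n)) (L : 'rV[R]_(n + n) -> R).
Hypothesis lc : local_cartan U L.
Variable c : R.
Hypothesis c0 : 0 < c.
Implicit Types (y z X : 'rV[R]_(n + n)).
Let oU := lc_open lc.
Let sL := lc_smooth lc.

Lemma fiber_scale_l l y i : fiber_scale l y 0 (lshift n i) = y 0 (lshift n i).
Proof. by rewrite row_mxEl mxE. Qed.

Lemma fiber_scale_r l y i :
  fiber_scale l y 0 (rshift n i) = l * y 0 (rshift n i).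
Proof. by rewrite row_mxEr !mxE. Qed.

Lemma fiber_scaleA l l' y :
  fiber_scale l (fiber_scale l' y) = fiber_scale (l * l') y.
Proof. by rewrite /fiber_scale row_mxKl row_mxKr scalerA. Qed.

Lemma fiber_scale1 y : fiber_scale 1 y = y.
Proof. by rewrite /fiber_scale scale1r hsubmxK. Qed.

Lemma Ck_fiber_scale (V : normedModType R) k (O : set V) (f : V -> R^o)
    (g : V -> 'rV[R]_(n + n)) : open O -> Ck k O f -> Ck k O g ->
  Ck k O (fun x => fiber_scale (f x) (g x)).
Proof.
move=> oO fC gC; apply: Ck_rV => // b; case: (split_ordP b) => i ->.
  by apply: eq_Ck (Ck_rVE (lshift n i) oO gC) => // x _; rewrite fiber_scale_l.
apply: eq_Ck (CkM oO fC (Ck_rVE (rshift n i) oO gC)) => // x _.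
by rewrite fiber_scale_r.
Qed.

Section Curve.
Variables (y0 X : 'rV[R]_(n + n)).
Hypotheses (Uy0 : U y0) (Ly0 : L y0 = c) (dX : 'D_X (L : _ -> R^o) y0 = 0).

Let w (t : R^o) : 'rV[R]_(n + n) := y0 + t *: X.

(** The straight line through [y0] with velocity [X], brought back to the level [c] by rescaling
    covectors. *)
Definition indicatrix_curve (t : R^o) : 'rV[R]_(n + n) :=
  fiber_scale (c / L (w t)) (w t).

Let Ck_w k (O : set R^o) : open O -> Ck k O w.
Proof.
move=> oO; apply: Ck_rV => // i.
have Cid : Ck k O (fun t : R^o => t : R^o).
  by apply: (@Ck_linear _ _ _ k O idfun) => ?.
have := CkD oO (Ck_cst k O (y0 0 i : R^o)) (CkM oO Cid (Ck_cst k O (X 0 i : R^o))).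
by apply: eq_Ck => // t _; rewrite !mxE.
Qed.

Let w0 : w 0 = y0. Proof. by rewrite /w scale0r addr0. Qed.

Let wc : continuous w.
Proof. by move=> t; apply: (Ck_w 0 openT). Qed.

(** Homogeneity puts the curve on the level. The factor [c / L (w t)] equals 1 at 0 and is
    stationary there because [dL] vanishes on [X], so rescaling does not change the initial
    velocity. *)
Lemma indicatrix_curveP : exists e : R, [/\ 0 < e,
  indicatrix_curve 0 = y0,
  forall t : R, `|t| < e -> U (indicatrix_curve t) /\ L (indicatrix_curve t) = c,
  smooth (ball (0 : R^o) e) indicatrix_curve &
  derive1 (indicatrix_curve : R -> _) 0 = X].
Proof.
have oO : open (w @^-1` U) by apply: open_comp => // t _; exact: wc.
have : nbhs (0 : R^o) (w @^-1` U).
  by apply: open_nbhs_nbhs; split=> //=; rewrite w0.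
move=> /nbhs_ballP[e /= e0 eU].
have we t : `|t| < e -> U (w t).
  by move=> te; apply: eU; rewrite -ball_normE /= sub0r normrN.
have smO : smooth (w @^-1` U) indicatrix_curve.
  move=> k; apply: Ck_fiber_scale => //; last exact: Ck_w.
  apply: CkM => //; first exact: Ck_cst.
  have LC : Ck k (w @^-1` U) (fun t => L (w t) : R^o).
    by apply: (@Ck_comp _ _ _ k (w @^-1` U) U (L : _ -> R^o) w) => //; exact: Ck_w.
  by apply: CkV => // t Ut; rewrite gt_eqF // (L_gt0 lc).
exists e; split=> //.
- by rewrite /indicatrix_curve w0 Ly0 divff ?fiber_scale1 // gt_eqF.
- move=> t /we Uw; have Lw := L_gt0 lc Uw.
  have cL : 0 < c / L (w t) by rewrite divr_gt0.
  split; first exact: (lc_cone lc).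
  by rewrite (lc_hom lc) // divfK // gt_eqF.
- by move=> k; apply: sub_Ck (smO k).
rewrite derive1E.
have U0 : (w @^-1` U) 0 by rewrite /= w0.
have dw : differentiable w 0 by exact: (Ck_diff (Ck_w 1 openT)).
have Dw : 'D_1 w 0 = X.
  rewrite deriveE // -[w]/(cst y0 + *:%R^~ X).
  have -> : 'd (cst y0 + *:%R^~ X) (0 : R^o) = (0 + *:%R^~ X) :> (R^o -> _).
    exact: (@diff_val _ _ _ _ _ _ _
      (is_diffD (is_diff_cst y0 (0 : R^o)) (is_diff_scalel (0 : R^o) X))).
  by rewrite /= fctE add0r scale1r.
have dLw : differentiable (fun t => L (w t) : R^o) (0 : R^o).
  apply: (@differentiable_comp _ _ _ _ w (L : _ -> R^o)) => //.
  by rewrite w0; exact: (L_diff lc).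
have DLw : 'D_1 (fun t => L (w t) : R^o) (0 : R^o) = 0.
  have dL0 : differentiable (L : _ -> R^o) (w 0) by rewrite w0; exact: (L_diff lc).
  by have := @derive_comp R R^o _ R^o (L : _ -> R^o) w 0 1 dw dL0; rewrite Dw w0 dX.
have Lw0 : L (w 0) != 0 by rewrite w0 Ly0 gt_eqF.
apply/rowP => b; rewrite derive_mxE; last exact: (smooth_diff smO).
have dwb := differentiable_rVE b dw.
case: (split_ordP b) => i bE; rewrite bE in dwb *.
  rewrite (_ : (fun t => _) = (fun t => w t 0 (lshift n i) : R^o)).
    by rewrite -derive_mxE // Dw.
  by apply/funext => t; rewrite fiber_scale_l.
pose f : R^o -> R^o := cst c * (fun t => (L (w t))^-1).
have dV : derivable (fun t => (L (w t))^-1 : R^o) (0 : R^o) (1 : R^o).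
  by apply: derivableV => //; exact: diff_derivable.
have dc : derivable (cst c : R^o -> R^o) (0 : R^o) (1 : R^o).
  exact: derivable_cst.
have df : derivable f (0 : R^o) (1 : R^o) by exact: (derivableM dc dV).
have dLd : derivable (fun t => L (w t) : R^o) (0 : R^o) (1 : R^o).
  exact: diff_derivable.
have Df : 'D_(1 : R^o) f (0 : R^o) = 0.
  rewrite (deriveM dc dV) derive_cst (deriveV Lw0 dLd).
  by rewrite DLw !scaler0 addr0.
have dwd : derivable (fun t => w t 0 (rshift n i) : R^o) (0 : R^o) (1 : R^o).
  exact: diff_derivable.
rewrite (_ : (fun t => _) = f * (fun t => w t 0 (rshift n i) : R^o)); last first.
  by apply/funext => t; rewrite /indicatrix_curve fiber_scale_r.
rewrite (deriveM df dwd) Df.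
have f1 : f 0 = 1.
  by rewrite -[f 0]/(c / L (w 0)) w0 Ly0 divff // gt_eqF.
by rewrite f1 scaler0 addr0 -derive_mxE // Dw scale1r.
Qed.

End Curve.

Section SliceChart.
Variables (k0 : 'I_n) (y0 : 'rV[R]_(n + n)).
Hypothesis (Uy0 : U y0).
Hypothesis (pk0 : y0 0 (rshift n k0) != 0).

(** The sign makes [omega] equal to [|p_k0|] near [y0]: a smooth positive function of degree 1 in
    [p], linear in the coordinates, to be exchanged with [L]. *)
Let s : R := Num.sg (y0 0 (rshift n k0)).
Let omega y : R := s * y 0 (rshift n k0).

Definition slice_domain : set 'rV[R]_(n + n) := U `&` [set y | 0 < omega y].

Let s2 : s * s = 1.
Proof. by rewrite /s -expr2 sqr_sg pk0. Qed.

Lemma slice_domain_y0 : slice_domain y0.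
Proof. by split=> //=; rewrite /omega /s -normrEsg normr_gt0. Qed.

Let omega_smooth k O : open O -> Ck k O (omega : _ -> R^o).
Proof.
move=> oO; apply: CkM => //; first exact: Ck_cst.
apply: (@Ck_rVE _ _ k O _ (fun y : 'rV[R]_(n + n) => y)) => //.
by apply: (@Ck_linear _ _ _ k O idfun) => ?.
Qed.

Lemma slice_domain_open : open slice_domain.
Proof.
apply: openI => //; apply: (@open_comp _ _ omega [set t | 0 < t]).
  by move=> y _; exact: (omega_smooth 0 openT).
exact: open_gt.
Qed.

Let omegaZ l y : omega (fiber_scale l y) = l * omega y.
Proof. by rewrite /omega fiber_scale_r mulrCA. Qed.

Lemma slice_domain_cone l y : 0 < l -> slice_domain y ->
  slice_domain (fiber_scale l y).
Proof.
move=> l0 [Uy wy]; split; first exact: (lc_cone lc).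
by rewrite /= omegaZ mulr_gt0.
Qed.

(* [flip] and [unflip] exchange the roles of [omega] and [L], so that [flip] sends
   the level sets of [L] to hyperplanes. *)
Let flip y := fiber_scale (L y / omega y) y.
Let unflip y := fiber_scale (omega y / L y) y.

Let flip_gt0 y : slice_domain y -> 0 < L y / omega y.
Proof. by move=> [Uy wy]; rewrite divr_gt0 // (L_gt0 lc). Qed.

Let unflip_gt0 y : slice_domain y -> 0 < omega y / L y.
Proof. by move=> [Uy wy]; rewrite divr_gt0 // (L_gt0 lc). Qed.

Let flipK y : slice_domain y -> unflip (flip y) = y.
Proof.
move=> Dy; have [Uy wy] := Dy; have Ly := L_gt0 lc Uy; have f0 := flip_gt0 Dy.
rewrite /unflip /flip omegaZ (lc_hom lc) // fiber_scaleA.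
rewrite (_ : _ * _ = 1) ?fiber_scale1 //.
have w0 : omega y != 0 by rewrite gt_eqF.
have L0 : L y != 0 by rewrite gt_eqF.
by field; rewrite w0 L0.
Qed.

Let unflipK y : slice_domain y -> flip (unflip y) = y.
Proof.
move=> Dy; have [Uy wy] := Dy; have Ly := L_gt0 lc Uy; have f0 := unflip_gt0 Dy.
rewrite /unflip /flip omegaZ (lc_hom lc) // fiber_scaleA.
rewrite (_ : _ * _ = 1) ?fiber_scale1 //.
have w0 : omega y != 0 by rewrite gt_eqF.
have L0 : L y != 0 by rewrite gt_eqF.
by field; rewrite w0 L0.
Qed.

Let omega_flip y : slice_domain y -> omega (flip y) = L y.
Proof. by move=> [_ wy]; rewrite omegaZ divfK // gt_eqF. Qed.

Lemma slice_chart (e : 'I_(n + n)) :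
  exists Phi Psi : 'rV[R]_(n + n) -> 'rV[R]_(n + n),
  [/\ open (Phi @` slice_domain), smooth slice_domain Phi,
      smooth (Phi @` slice_domain) Psi,
      forall y, slice_domain y -> Psi (Phi y) = y &
      forall y, slice_domain y -> (L y = c <-> Phi y 0 e = 0)].
Proof.
(* Transposition of coordinates that brings the distinguished momentum [p_k0] to the slot [e]. *)
pose sw y : 'rV[R]_(n + n) := \row_i y 0 (tperm (rshift n k0) e i).
have swK : involutive sw by move=> y; apply/rowP => i; rewrite !mxE tpermK.
have sw_lin k (V : normedModType R) (O : set V) (f : V -> 'rV[R]_(n + n)) :
    open O -> Ck k O f -> Ck k O (fun x => sw (f x)).
  move=> oO fC; apply: Ck_rV => // i.
  by apply: eq_Ck (Ck_rVE (tperm (rshift n k0) e i) oO fC) => // x _; rewrite mxE.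
(* After [flip] the momentum [p_k0] is [s * L y], since [s * s = 1]; it is [s * c] exactly on the
   level, and the translation by [v0] moves this value to 0. *)
pose v0 : 'rV[R]_(n + n) := (s * c) *: delta_mx 0 e.
pose Phi y := sw (flip y) + - v0.
pose A z := sw (z + v0).
have idC k (O : set 'rV[R]_(n + n)) : Ck k O (fun y => y).
  by apply: (@Ck_linear _ _ _ k O idfun) => ?.
have AC k (O : set 'rV[R]_(n + n)) : open O -> Ck k O A.
  by move=> oO; apply: sw_lin => //; apply: CkD => //; exact: Ck_cst.
have oD := slice_domain_open.
have LC k : Ck k slice_domain (L : _ -> R^o).
  by apply: sub_Ck (sL k) => y [].
have flipC k : Ck k slice_domain flip.
  apply: Ck_fiber_scale => //; apply: CkM => //.
  by apply: CkV => //; [move=> y [_ wy]; rewrite gt_eqF | exact: omega_smooth].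
have unflipC k : Ck k slice_domain unflip.
  apply: Ck_fiber_scale => //; apply: CkM => //; first exact: omega_smooth.
  by apply: CkV => // y [Uy _]; rewrite gt_eqF // (L_gt0 lc).
(* As [flip] and [unflip] are mutually inverse on the conical domain, the image is the preimage of
   that domain under the continuous map [A]. It is therefore open with no inverse function
   theorem. *)
have imE : Phi @` slice_domain = A @^-1` slice_domain.
  apply/seteqP; split=> [_ [y Dy <-]|z Dz] /=.
    rewrite /A /Phi subrK swK /flip.
    by apply: slice_domain_cone => //; exact: flip_gt0.
  exists (unflip (A z)).
    by apply: slice_domain_cone => //; exact: unflip_gt0.
  by rewrite /Phi unflipK // /A swK addrK.
have oV : open (Phi @` slice_domain).
  rewrite imE; apply: open_comp => // z _; exact: (AC 0 _ openT).
exists Phi, (unflip \o A); split=> //.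
- move=> k; apply: CkD => //; last exact: Ck_cst.
  exact: sw_lin.
- move=> k; apply: Ck_rV => // i.
  apply: (@Ck_comp _ _ _ k _ slice_domain (fun y => unflip y 0 i : R^o) A) => //.
  + by move=> z; rewrite imE.
  + exact: Ck_rVE.
  + exact: AC.
- by move=> y Dy; rewrite /= /A /Phi subrK swK flipK.
move=> y Dy.
have -> : Phi y 0 e = s * (L y - c).
  rewrite mulrBr -(omega_flip Dy) /omega mulrA s2 mul1r /Phi.
  by move: (flip y) => z; rewrite !mxE !eqxx mulr1 tpermR.
split=> [->|/eqP]; first by rewrite subrr mulr0.
rewrite mulf_eq0 subr_eq0 => /orP[/eqP s0|/eqP //].
by have := s2; rewrite s0 mulr0 => /esym/eqP; rewrite oner_eq0.
Qed.

End SliceChart.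
End LocalIndicatrix.

Lemma local_exprE (R : realType) m (A : atlas R m) (W : normedModType R)
    (f : point A -> W) a u :
  (forall v, dom a v -> coord a u = coord a v -> v = u) -> dom a u ->
  local_expr f a (coord a u) = f u.
Proof.
move=> inj du; rewrite /local_expr.
have Q : [set z | exists v, [/\ dom a v, coord a v = coord a u & f v = z]] (f u).
  by exists u.
have /= [v [dv vu <-]] := xgetPex 0 (ex_intro _ _ Q).
by rewrite (inj v).
Qed.

(** * Coordinate changes on the cotangent bundle *)

Section Symplectic.
Variables (R : realType) (n : nat).
Implicit Types (X Y Z : 'rV[R]_(n + n)).

(** The fundamental form [Omega = dp_i /\ dx^i], which is d theta. *)
Definition symplectic_form X Y : R :=
  \sum_i (X 0 (rshift n i) * Y 0 (lshift n i) -
          X 0 (lshift n i) * Y 0 (rshift n i)).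

Lemma symplectic_form_nondeg X Y :
  (forall Z, symplectic_form X Z = symplectic_form Y Z) -> X = Y.
Proof.
move=> XY; apply/rowP => k; case: (split_ordP k) => i ->.
  have := XY (ddp R i); rewrite /symplectic_form.
  under eq_bigr => j _ do rewrite ddp_l ddp_r mulr0 sub0r eq_sym -mulrN.
  under [in RHS]eq_bigr => j _ do rewrite ddp_l ddp_r mulr0 sub0r eq_sym -mulrN.
  rewrite (bigD1 i) //= [in RHS](bigD1 i) //= eqxx !big1 ?addr0.
  - by rewrite !mulrN1 => /oppr_inj.
  - by move=> j /negPf ->; rewrite oppr0 mulr0.
  - by move=> j /negPf ->; rewrite oppr0 mulr0.
have := XY (ddx R i); rewrite /symplectic_form.
under eq_bigr => j _ do rewrite ddx_l ddx_r mulr0 subr0 eq_sym.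
under [in RHS]eq_bigr => j _ do rewrite ddx_l ddx_r mulr0 subr0 eq_sym.
by rewrite !sum_delta.
Qed.

(** Hamilton's equation for [K^2/2]. With nondegeneracy it determines the field from [Omega] and
    [d(K^2/2)] alone. *)
Lemma symplectic_hamilton (U : set 'rV[R]_(n + n)) L y Y :
  local_cartan U L -> U y ->
  symplectic_form (hamilton_field L y) Y = - (L y * 'D_Y (L : _ -> R^o) y).
Proof.
move=> lc Uy; rewrite derive_ddxp; last exact: (L_diff lc).
rewrite /symplectic_form sumrB mulrDr opprD; congr (_ - _).
  rewrite mulr_sumr -sumrN; apply: eq_bigr => i _.
  by rewrite row_mxEr mxE mulNr -mulrA [pdx i L y * _]mulrC.
rewrite mulr_sumr; apply: eq_bigr => i _.
by rewrite row_mxEl mxE (p_upE lc i Uy) -mulrA [pdp i L y * _]mulrC.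
Qed.

Section Transport.
Variables (O : set 'rV[R]_(n + n)) (T : 'rV[R]_(n + n) -> 'rV[R]_(n + n)).
Hypotheses (oO : open O) (sT : smooth O T).
Hypothesis theta_T : forall y Y, O y ->
  liouville_form (T y) ('D_Y T y) = liouville_form y Y.

Let Tl i (y : 'rV[R]_(n + n)) : R^o := T y 0 (lshift n i).
Let Tr i (y : 'rV[R]_(n + n)) : R^o := T y 0 (rshift n i).

Let sTl i : smooth O (Tl i).
Proof. by move=> k; exact: Ck_rVE. Qed.

Let sTr i : smooth O (Tr i).
Proof. by move=> k; exact: Ck_rVE. Qed.

(* The derivative along [X] of [theta_T], whose antisymmetric part in [X], [Y] is
   the invariance of [d theta]. *)
Lemma derive_theta_T y X Y : O y ->
  \sum_i ('D_X (Tr i) y * 'D_Y (Tl i) y +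
          Tr i y * 'D_X (fun z => 'D_Y (Tl i) z) y) =
  \sum_i X 0 (rshift n i) * Y 0 (lshift n i).
Proof.
move=> Oy; rewrite -derive_sumM; last 2 first.
- by move=> i; exact: (smooth_diff (sTr i)).
- by move=> i; exact: (smooth_diff (smooth_derive Y (sTl i))).
transitivity ('D_X (fun z : 'rV[R]_(n + n) =>
    \sum_i z 0 (rshift n i) * Y 0 (lshift n i) : R^o) y).
  apply: (eq_derive_open _ oO) => // z Oz.
  have dT : differentiable T z by exact: (smooth_diff sT).
  transitivity (liouville_form (T z) ('D_Y T z)).
    apply: eq_bigr => i _; rewrite (derive_mxE _ _ dT) /p_dn.
    by congr (_ * _); rewrite mxE.
  rewrite theta_T //; apply: eq_bigr => i _.
  by congr (_ * _); rewrite /p_dn mxE.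
rewrite (derive_sumM (f := fun i (z : 'rV[R]_(n + n)) => z 0 (rshift n i) : R^o)
  (g := fun i => cst (Y 0 (lshift n i) : R^o))).
- by apply: eq_bigr => i _; rewrite derive_cst mulr0 addr0 derive_coord.
- by move=> i; exact: differentiable_coord.
- by move=> i; exact: differentiable_cst.
Qed.

(** Subtract [derive_theta_T] for [Y], [X] from the same identity for [X], [Y]: the second
    derivatives of [T] cancel by [derive_comm]. *)
Lemma symplectic_T y X Y : O y ->
  symplectic_form ('D_X T y) ('D_Y T y) = symplectic_form X Y.
Proof.
move=> Oy.
have XY := derive_theta_T X Y Oy; have YX := derive_theta_T Y X Oy.
have -> : symplectic_form X Y = \sum_i X 0 (rshift n i) * Y 0 (lshift n i)
    - \sum_i Y 0 (rshift n i) * X 0 (lshift n i).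
  by rewrite -sumrB; apply: eq_bigr => i _; rewrite [X 0 (lshift n i) * _]mulrC.
rewrite -XY -YX -sumrB; apply: eq_bigr => i _.
have dT : differentiable T y by exact: (smooth_diff sT).
have El Z : 'D_Z T y 0 (lshift n i) = 'D_Z (Tl i) y by exact: derive_mxE.
have Er Z : 'D_Z T y 0 (rshift n i) = 'D_Z (Tr i) y by exact: derive_mxE.
have alg (p q r t A B C D E F G : R) : p = A -> q = B -> r = F -> t = E -> D = G ->
    p * q - r * t = A * B + C * D - (E * F + C * G).
  by move=> -> -> -> -> ->; ring.
exact: (alg _ _ _ _ _ _ _ _ _ _ _ (Er X) (El Y) (El X) (Er Y)
  (derive_comm Y X oO (sTl i 2) Oy)).
Qed.

End Transport.
End Symplectic.

(** * Jacobians of the base charts and components of covectors *)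

Section BaseManifold.
Variables (R : realType) (n : nat) (M : manifold R n).
Implicit Types (a b c : chart M) (x : point M).
Let MP := manifoldP M.

Lemma local_expr_base (W : normedModType R) (f : point M -> W) a x :
  dom a x -> local_expr f a (coord a x) = f x.
Proof.
move=> dx; apply: local_exprE => // v dv E; apply: (coord_inj MP dv dx).
by rewrite E.
Qed.

Lemma transition_coord a b x : dom a x -> transition a b (coord a x) = coord b x.
Proof. by move=> dx; rewrite /transition local_expr_base. Qed.

(** Rests on injectivity of the chart; it makes triple overlaps open, as the cocycle rule
    [base_jacobianM] requires. *)
Lemma coord_setI (P Q : set (point M)) a :
  coord a @` (dom a `&` P) `&` coord a @` (dom a `&` Q) =
  coord a @` (dom a `&` (P `&` Q)).
Proof.
apply/seteqP; split=> [_ [[x [dx Px] <-] [x' [dx' Qx'] E]]|_ [x [dx [Px Qx]] <-]].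
  have xx := coord_inj MP dx' dx E; rewrite xx in Qx'.
  by exists x.
by split; exists x.
Qed.

(** The row index is the variable of differentiation, so tangent rows are multiplied on the right by
    this matrix, and covector rows by the transpose of the Jacobian of the reverse change. *)
Definition base_jacobian a b x : 'M[R]_n :=
  \matrix_(i, j) 'D_(delta_mx 0 i) (transition a b) (coord a x) 0 j.

Lemma transition_diff a b x : dom a x -> dom b x ->
  differentiable (transition a b) (coord a x).
Proof.
by move=> ax bx; apply: (smooth_diff (transition_smooth MP a b)); exists x.
Qed.

Lemma derive_transition a b x v : dom a x -> dom b x ->
  'D_v (transition a b) (coord a x) = v *m base_jacobian a b x.
Proof.
move=> ax bx; rewrite derive_sumE; last exact: transition_diff.
apply/rowP => j; rewrite summxE mxE; apply: eq_bigr => i _.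
by rewrite !mxE.
Qed.

Lemma base_jacobianM a b c x : dom a x -> dom b x -> dom c x ->
  base_jacobian a c x = base_jacobian a b x *m base_jacobian b c x.
Proof.
move=> ax bx cx; apply/row_matrixP => i.
have dab := transition_diff ax bx.
have dbc : differentiable (transition b c) (transition a b (coord a x)).
  rewrite (transition_coord b ax); exact: transition_diff.
have := derive_comp (delta_mx 0 i) dab dbc.
rewrite (derive_transition _ ax bx) (transition_coord b ax) (derive_transition _ bx cx).
rewrite row_mul !rowE => <-; rewrite -(derive_transition _ ax cx).
have oI : open (coord a @` (dom a `&` (dom b `&` dom c))).
  by rewrite -coord_setI; apply: openI; exact: (overlap_open MP).
apply: (eq_derive_open _ oI); first by exists x.
by move=> _ [z [az [bz cz]] <-] /=; rewrite !transition_coord.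
Qed.

Lemma base_jacobian1 a x : dom a x -> base_jacobian a a x = 1%:M.
Proof.
move=> ax; apply/row_matrixP => i; rewrite !rowE -(derive_transition _ ax ax) mulmx1.
rewrite -[RHS](derive_id (coord a x)).
apply: (eq_derive_open _ (@overlap_open _ _ _ MP a a)); first by exists x.
by move=> _ [z [az _] <-]; rewrite transition_coord.
Qed.

Lemma base_jacobianK a b x : dom a x -> dom b x ->
  base_jacobian a b x *m base_jacobian b a x = 1%:M.
Proof. by move=> ax bx; rewrite -base_jacobianM // base_jacobian1. Qed.

Lemma covector_coordE a (u : cotangent M) :
  covector_coord a u = u.2 *m (base_jacobian a (chart_at u.1) u.1)^T.
Proof.
apply/rowP => i; rewrite !mxE; apply: eq_bigr => j _; by rewrite !mxE.
Qed.

Lemma covector_coord_change a b (u : cotangent M) : dom a u.1 -> dom b u.1 ->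
  covector_coord b u = covector_coord a u *m (base_jacobian b a u.1)^T.
Proof.
move=> au bu; have cu := chart_atP MP u.1.
by rewrite !covector_coordE -mulmxA -trmx_mul -base_jacobianM.
Qed.

Lemma covector_coord_at (u : cotangent M) : covector_coord (chart_at u.1) u = u.2.
Proof.
by rewrite covector_coordE base_jacobian1 ?trmx1 ?mulmx1 //; exact: (chart_atP MP).
Qed.

Lemma covector_coord_surj a x (q : 'rV[R]_n) : dom a x ->
  exists p, covector_coord a (x, p) = q.
Proof.
move=> ax; have cx := chart_atP MP x.
exists (q *m (base_jacobian (chart_at x) a x)^T).
by rewrite covector_coordE /= -mulmxA -trmx_mul base_jacobianK // trmx1 mulmx1.
Qed.

Lemma covector_coord_eq0 a (u : cotangent M) : dom a u.1 ->
  (covector_coord a u == 0) = (u.2 == 0).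
Proof.
move=> au; apply/eqP/eqP => [E|E].
  by rewrite -covector_coord_at (covector_coord_change au (chart_atP MP _)) E mul0mx.
by rewrite covector_coordE E mul0mx.
Qed.

Lemma covector_coord_inj a x (p p' : 'rV[R]_n) : dom a x ->
  covector_coord a ((x, p) : cotangent M) = covector_coord a (x, p') -> p = p'.
Proof.
move=> ax E; have cx := chart_atP MP x.
rewrite -[p]/((x, p).2) -(covector_coord_at (x, p)).
rewrite -[p' in RHS]/((x, p').2) -(covector_coord_at (x, p')) /=.
rewrite (covector_coord_change (u := (x, p)) ax cx) E.
exact: esym (covector_coord_change (u := (x, p')) ax cx).
Qed.

Lemma covector_coordZ a x p (l : R) :
  covector_coord a ((x, l *: p) : cotangent M) = l *: covector_coord a (x, p).
Proof. by rewrite !covector_coordE /= scalemxAl. Qed.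

End BaseManifold.

(** * The induced charts of the punctured cotangent bundle *)

Section Cotangent.
Variables (R : realType) (n : nat) (M : manifold R n).
Implicit Types (a b : chart M).
Local Notation TM0 := (cotangent0_atlas M).
Implicit Types (u v : point TM0).
Let MP := manifoldP M.

Local Notation tdom a := (@dom R (n + n) TM0 a).
Local Notation tcoord a := (@coord R (n + n) TM0 a).

Lemma tcoord_l a u : lsubmx (tcoord a u) = coord a (val u).1.
Proof. by rewrite /= row_mxKl. Qed.

Lemma tcoord_r a u : rsubmx (tcoord a u) = covector_coord a (val u).
Proof. by rewrite /= row_mxKr. Qed.

Lemma tcoord_inj a u v : tdom a u -> tdom a v -> tcoord a u = tcoord a v -> u = v.
Proof.
move=> au av E; apply: val_inj.
have /(coord_inj MP au av) E1 : coord a (val u).1 = coord a (val v).1.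
  by rewrite -!tcoord_l E.
have E2 : covector_coord a (val u) = covector_coord a (val v).
  by rewrite -!tcoord_r E.
have ax : dom a (val u).1 := au.
case: (val u) (val v) ax E1 E2 => [x p] [x' p'] /= ax <- E2.
by congr (_, _); exact: covector_coord_inj ax E2.
Qed.

Lemma local_expr_cotangent (W : normedModType R) (f : point TM0 -> W) a u :
  tdom a u -> local_expr (A := TM0) f a (tcoord a u) = f u.
Proof.
move=> du; exact: (@local_exprE _ _ TM0 _ f a u
  (fun v dv E => tcoord_inj dv du (esym E)) du).
Qed.

(** On each fibre the components range over all nonzero rows, so the image is a product and its
    openness reduces to that of the base image. *)
Lemma tcoord_image a (P : set (point M)) :
  tcoord a @` (tdom a `&` [set u | P (val u).1]) =
  [set y | (coord a @` (dom a `&` P)) (lsubmx y) /\ rsubmx y != 0].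
Proof.
apply/seteqP; split=> [_ [u [/= au Pu] <-]|y [[x [ax Px] xy] y0]] /=.
  rewrite row_mxKl row_mxKr covector_coord_eq0 //; split; last exact: (valP u).
  by exists (val u).1.
have [p pE] := covector_coord_surj (rsubmx y) ax.
have p0 : p != 0 by rewrite -[p]/((x, p).2) -(covector_coord_eq0 (u := (x, p)) ax) pE.
exists (exist _ (x, p) p0 : point TM0); first by split.
by rewrite /= pE xy hsubmxK.
Qed.

Lemma open_cotangent (S : set 'rV[R]_n) : open S ->
  open [set y : 'rV[R]_(n + n) | S (lsubmx y) /\ rsubmx y != 0].
Proof.
move=> oS; have -> : [set y : 'rV[R]_(n + n) | S (lsubmx y) /\ rsubmx y != 0] =
    (lsubmx @^-1` S) `&` (rsubmx @^-1` (~` [set 0])).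
  by apply/seteqP; split=> y [Sy /eqP y0].
apply: openI; apply: open_comp => //.
- by move=> y _; exact: continuous_lsubmx.
- by move=> y _; exact: continuous_rsubmx.
apply: closed_openC; apply: accessible_closed_set1.
exact: hausdorff_accessible (@norm_hausdorff _ _).
Qed.

Lemma tdom_open a : open (tcoord a @` tdom a).
Proof.
have -> : tdom a = tdom a `&` [set u | dom a (val u).1].
  by apply/seteqP; split=> u //= [].
by rewrite tcoord_image; apply: open_cotangent; exact: (overlap_open MP).
Qed.

Lemma toverlap_open a b : open (tcoord a @` (tdom a `&` tdom b)).
Proof. by rewrite tcoord_image; apply: open_cotangent; exact: (overlap_open MP). Qed.

Local Notation ttrans a b := (@transition R (n + n) TM0 a b).

Lemma ttrans_coord a b u : tdom a u -> ttrans a b (tcoord a u) = tcoord b u.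
Proof. by move=> du; rewrite /transition local_expr_cotangent. Qed.

Lemma ttrans_l a b u i : tdom a u ->
  ttrans a b (tcoord a u) 0 (lshift n i) =
  transition a b (lsubmx (tcoord a u)) 0 i.
Proof.
by move=> au; rewrite ttrans_coord // tcoord_l transition_coord //= row_mxEl.
Qed.

(** Stated through [tcoord a u] alone, so that it presents the transition as an explicit function on
    the chart image, smooth by composition of base transitions. *)
Lemma ttrans_r a b u i : tdom a u -> tdom b u ->
  ttrans a b (tcoord a u) 0 (rshift n i) =
  \sum_j rsubmx (tcoord a u) 0 j *
   'D_(delta_mx 0 i) (transition b a) (transition a b (lsubmx (tcoord a u))) 0 j.
Proof.
move=> au bu; rewrite ttrans_coord // tcoord_l tcoord_r transition_coord //= row_mxEr.
rewrite (covector_coord_change (a := a)) // mxE; apply: eq_bigr => j _.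
by rewrite !mxE.
Qed.

Lemma Ck_lsubmx k (O : set 'rV[R]_(n + n)) :
  Ck k O (lsubmx : 'rV[R]_(n + n) -> 'rV[R]_n).
Proof. by apply: Ck_linear; exact: continuous_lsubmx. Qed.

Lemma Ck_rsubmx k (O : set 'rV[R]_(n + n)) :
  Ck k O (rsubmx : 'rV[R]_(n + n) -> 'rV[R]_n).
Proof. by apply: Ck_linear; exact: continuous_rsubmx. Qed.

Lemma ttrans_smooth a b : smooth (tcoord a @` (tdom a `&` tdom b)) (ttrans a b).
Proof.
set O := _ @` _; have oO : open O := @toverlap_open a b.
have oab := @overlap_open _ _ _ MP a b; have oba := @overlap_open _ _ _ MP b a.
have lO y : O y -> (coord a @` (dom a `&` dom b)) (lsubmx y).
  by move=> [u [au bu] <-]; rewrite tcoord_l; exists (val u).1.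
have tO y : (coord a @` (dom a `&` dom b)) y ->
    (coord b @` (dom b `&` dom a)) (transition a b y).
  by move=> [x [ax bx] <-]; rewrite transition_coord //; exists x.
have tC k i : Ck k O (fun y => transition a b (lsubmx y) 0 i : R^o).
  apply: (@Ck_comp _ _ _ k O _ (fun z => transition a b z 0 i : R^o)
    lsubmx oO oab) => //.
    by apply: Ck_rVE => //; exact: (transition_smooth MP).
  exact: Ck_lsubmx.
have tvC k : Ck k O (fun y => transition a b (lsubmx y)).
  by apply: Ck_rV.
move=> k; apply: Ck_rV => // m; case: (split_ordP m) => i ->.
  apply: eq_Ck (tC k i) => // _ [u [au bu] <-].
  by rewrite ttrans_l.
apply: (@eq_Ck _ _ _ k O (fun y => \sum_j rsubmx y 0 j *
   'D_(delta_mx 0 i) (transition b a) (transition a b (lsubmx y)) 0 j : R^o)) => //.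
  by move=> _ [u [au bu] <-]; rewrite ttrans_r.
apply: Ck_sum => // j; apply: CkM => //; first exact: Ck_rVE (Ck_rsubmx _ _).
apply: (@Ck_comp _ _ _ k O _
  (fun z => 'D_(delta_mx 0 i) (transition b a) z 0 j : R^o)
  (fun y => transition a b (lsubmx y)) oO oba) => //.
  by move=> y /lO /tO.
by apply: Ck_rVE => //; exact: (smooth_derive _ (transition_smooth MP b a)).
Qed.

Lemma ttrans_diff a b u : tdom a u -> tdom b u ->
  differentiable (ttrans a b) (tcoord a u).
Proof. by move=> au bu; apply: (smooth_diff (@ttrans_smooth a b)); exists u. Qed.

(** The [x]-part of a vector is multiplied by the Jacobian from [a] to [b], and [p] by the transpose
    of the inverse Jacobian, so their pairing does not change. *)
Lemma liouville_form_ttrans a b u Y : tdom a u -> tdom b u ->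
  liouville_form (tcoord b u) ('D_Y (ttrans a b) (tcoord a u)) =
  liouville_form (tcoord a u) Y.
Proof.
move=> au bu; have dT := ttrans_diff au bu.
have El i : 'D_Y (ttrans a b) (tcoord a u) 0 (lshift n i) =
    (lsubmx Y *m base_jacobian a b (val u).1) 0 i.
  rewrite (derive_mxE _ _ dT).
  transitivity ('D_Y (fun y => (transition a b \o lsubmx) y 0 i : R^o) (tcoord a u)).
    apply: (eq_derive_open _ (@tdom_open a)); first by exists u.
    by move=> _ [v av <-]; rewrite ttrans_l.
  have dl : differentiable (lsubmx : 'rV[R]_(n + n) -> 'rV[R]_n) (tcoord a u).
    exact: differentiable_lsubmx.
  have dt : differentiable (transition a b) (lsubmx (tcoord a u)).
    by rewrite tcoord_l; exact: transition_diff.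
  rewrite -derive_mxE; last exact: differentiable_comp.
  rewrite derive_comp // tcoord_l derive_transition //.
  congr ((_ *m _) 0 i); rewrite deriveE // diff_lin //.
  exact: continuous_lsubmx.
rewrite /liouville_form; under eq_bigr => i _ do rewrite El.
transitivity ((covector_coord b (val u) *m
  (lsubmx Y *m base_jacobian a b (val u).1)^T) 0 0).
  rewrite [RHS]mxE; apply: eq_bigr => i _; congr (_ * _).
    by rewrite /p_dn tcoord_r.
  by rewrite [RHS]mxE.
rewrite (covector_coord_change (a := a)) // -mulmxA -trmx_mul -mulmxA.
rewrite base_jacobianK // mulmx1 mxE; apply: eq_bigr => i _; congr (_ * _).
  by rewrite /p_dn tcoord_r.
by rewrite !mxE.
Qed.

Lemma ttransK a b u Y : tdom a u -> tdom b u ->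
  'D_('D_Y (ttrans a b) (tcoord a u)) (ttrans b a) (tcoord b u) = Y.
Proof.
move=> au bu; have dab := ttrans_diff au bu.
have Tu := @ttrans_coord a b u au.
have dba : differentiable (ttrans b a) (ttrans a b (tcoord a u)).
  by rewrite Tu; exact: (ttrans_diff bu au).
have := derive_comp Y dab dba; rewrite Tu => <-.
rewrite -[RHS](derive_id (tcoord a u)).
apply: (eq_derive_open _ (@toverlap_open a b)).
  exact: (ex_intro2 _ _ u (conj au bu) erefl).
move=> _ [v [av bv] <-].
exact: (etrans (congr1 (ttrans b a) (@ttrans_coord a b v av)) (@ttrans_coord b a v bv)).
Qed.

End Cotangent.

(** * The indicatrix of a Cartan space *)

Section CartanCR.
Variables (R : realType) (n : nat) (M : manifold R n) (K : cotangent M -> R).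
Hypothesis hK : cartan_structure K.
Local Notation TM0 := (cotangent0_atlas M).
Local Notation tdom a := (@dom R (n + n) TM0 a).
Local Notation tcoord a := (@coord R (n + n) TM0 a).
Local Notation ttrans a b := (@transition R (n + n) TM0 a b).
Local Notation at_ u := (@chart_at R (n + n) TM0 u).
Implicit Types (a b : chart M) (u v : point TM0) (X Y : 'rV[R]_(n + n)).

Lemma tdom_at u : tdom (at_ u) u.
Proof. exact: (chart_atP (manifoldP M) (val u).1). Qed.

Lemma K_locE a u : tdom a u -> K_loc K a (tcoord a u) = K (val u).
Proof. exact: (@local_expr_cotangent R n M R^o (@K0 R n M K) a u). Qed.

Lemma fiber_scale_tcoord a u l : 0 < l -> tdom a u ->
  exists v, [/\ tdom a v, tcoord a v = fiber_scale l (tcoord a u) &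
    K (val v) = l * K (val u)].
Proof.
move=> l0 au.
have p0 : l *: (val u).2 != 0 by rewrite scaler_eq0 negb_or gt_eqF //; exact: (valP u).
exists (exist _ ((val u).1, l *: (val u).2) p0 : point TM0); split => //.
  rewrite /fiber_scale tcoord_l tcoord_r -[LHS]/(row_mx _ _) covector_coordZ.
  by rewrite -surjective_pairing.
rewrite [RHS](_ : _ = l * K ((val u).1, (val u).2)).
  by rewrite -(cartan_homogeneous hK).
by rewrite -surjective_pairing.
Qed.

Lemma cartan_local a : local_cartan (tcoord a @` tdom a) (K_loc K a).
Proof.
split.
- exact: tdom_open.
- exact: (cartan_smooth hK).
- by move=> _ [u au <-]; rewrite (K_locE au); exact: (cartan_ge0 hK).
- move=> _ [u au <-]; rewrite tcoord_r (covector_coord_eq0 au).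
  exact: (valP u).
- move=> l _ l0 [u au <-]; have [v [av <- _]] := fiber_scale_tcoord l0 au.
  by exists v.
- move=> l _ l0 [u au <-]; have [v [av <- Kv]] := fiber_scale_tcoord l0 au.
  exact: (etrans (K_locE av) (etrans Kv (congr1 ( *%R l) (esym (K_locE au))))).
- by move=> _ [u au <-]; exact: (cartan_posdef hK au).
Qed.

Lemma image_tcoord a u : tdom a u -> (tcoord a @` tdom a) (tcoord a u).
Proof. by move=> au; exact: (ex_intro2 _ _ u au erefl). Qed.

Lemma derive_K_loc_ttrans a b u X : tdom a u -> tdom b u ->
  'D_('D_X (ttrans a b) (tcoord a u)) (K_loc K b : _ -> R^o) (tcoord b u) =
  'D_X (K_loc K a : _ -> R^o) (tcoord a u).
Proof.
move=> au bu; have dab := ttrans_diff au bu.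
have Tu := @ttrans_coord _ _ _ a b u au.
have dK0 : differentiable (K_loc K b : _ -> R^o) (tcoord b u).
  exact: (L_diff (cartan_local b) (image_tcoord bu)).
have dK : differentiable (K_loc K b : _ -> R^o) (ttrans a b (tcoord a u)).
  by rewrite Tu.
have E := derive_comp X dab dK.
rewrite Tu in E.
apply: (etrans (esym E)).
apply: (eq_derive_open _ (@toverlap_open _ _ _ a b)).
  exact: (ex_intro2 _ _ u (conj au bu) erefl).
move=> _ [v [av bv] <-].
apply: (etrans (congr1 (K_loc K b) (@ttrans_coord _ _ _ a b v av))).
exact: (etrans (K_locE bv) (esym (K_locE av))).
Qed.

(** Both sides solve Hamilton's equation in the chart [b]: the transition preserves the symplectic
    form, [K] and [dK], and by [ttransK] every test vector [Z] is the image of some [Y]. *)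
Lemma hamilton_field_ttrans a b u : tdom a u -> tdom b u ->
  'D_(hamilton_field (K_loc K a) (tcoord a u)) (ttrans a b) (tcoord a u) =
  hamilton_field (K_loc K b) (tcoord b u).
Proof.
move=> au bu; apply: symplectic_form_nondeg => Z.
have [Y ZE] : exists Y, 'D_Y (ttrans a b) (tcoord a u) = Z.
  by exists ('D_Z (ttrans b a) (tcoord b u)); exact: ttransK.
have theta_T y' Y' : (tcoord a @` (tdom a `&` tdom b)) y' ->
    liouville_form (ttrans a b y') ('D_Y' (ttrans a b) y') = liouville_form y' Y'.
  move=> [v [av bv] <-].
  apply: etrans (liouville_form_ttrans Y' av bv).
  exact: (congr1 (fun z => liouville_form z _) (@ttrans_coord _ _ _ a b v av)).
have E1 := symplectic_T (@toverlap_open _ _ _ a b) (@ttrans_smooth _ _ _ a b) theta_T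
  (hamilton_field (K_loc K a) (tcoord a u)) Y (ex_intro2 _ _ u (conj au bu) erefl).
have E2 := symplectic_hamilton Y (cartan_local a) (image_tcoord au).
have E3 := symplectic_hamilton Z (cartan_local b) (image_tcoord bu).
have E4 := derive_K_loc_ttrans Y au bu.
apply: etrans (etrans _ (esym E3)).
  exact: etrans (congr1 (symplectic_form _) (esym ZE)) (etrans E1 E2).
have E5 := congr1 (fun W => 'D_W (K_loc K b : _ -> R^o) (tcoord b u)) ZE.
have E6 : K_loc K a (tcoord a u) = K_loc K b (tcoord b u).
  exact: (etrans (K_locE au) (esym (K_locE bu))).
exact: (congr1 -%R (congr2 *%R E6 (etrans (esym E4) E5))).
Qed.

Section Level.
Variables (c : R) (hc : 0 < c).
Local Notation N := (indicatrix K c).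

Lemma indicatrix_loc a u : tdom a u -> (N u <-> K_loc K a (tcoord a u) = c).
Proof. by move=> au; rewrite (K_locE au). Qed.

(** Along a curve of the indicatrix [K] is constant, whence [dK = 0] on its velocity. Conversely the
    curve of [indicatrix_curveP] is lifted to points through the chart. *)
Lemma tangent_indicatrix u X : N u ->
  tangent N u X <-> 'D_X (K_loc K (at_ u) : _ -> R^o) (tcoord (at_ u) u) = 0.
Proof.
move=> Nu; set a := at_ u; have au : tdom a u := tdom_at u.
have lc := cartan_local a; have Uu := image_tcoord au.
split.
  move=> [gam [e [e0 g0 gN sg <-]]].
  have b0 : ball (0 : R^o) e 0 by exact: ballxx.
  have dg : differentiable (tcoord a \o gam : R^o -> _) (0 : R^o).
    exact: (smooth_diff sg b0).
  have dK : differentiable (K_loc K a : _ -> R^o) ((tcoord a \o gam) 0).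
    by rewrite /= g0; exact: (L_diff lc Uu).
  have := @derive_comp R R^o _ R^o (K_loc K a) (tcoord a \o gam) 0 1 dg dK.
  rewrite derive1E [(tcoord a \o gam) 0]/= g0 => <-.
  rewrite -[RHS](derive_cst (c : R^o) (0 : R^o) (1 : R^o)).
  apply: (eq_derive_open (U := ball (0 : R^o) e)) => //; first exact: ball_open.
  move=> t; rewrite -ball_normE /= sub0r normrN => te.
  have [Ngt dgt] := gN t te.
  exact: (etrans (K_locE dgt) Ngt).
move=> dX; have Lu := (indicatrix_loc au).1 Nu.
have [e [e0 c0 cP sc dc]] := indicatrix_curveP lc hc Uu Lu dX.
(* Outside the interval the value is the arbitrary point [u]; only times with [|t| < e] matter for
   the smoothness and the velocity at 0. *)
have /choice[gam gamP] (t : R) : exists v, `|t| < e ->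
    [/\ tdom a v, tcoord a v = indicatrix_curve (K_loc K a) c (tcoord a u) X t & N v].
  have [te|] := boolP (`|t| < e); last by move=> _; exists u.
  have [[v av vE] Lv] := cP t te.
  exists v => _; split => //; apply/(indicatrix_loc av); by rewrite vE.
have gE t : `|t| < e ->
    (tcoord a \o gam) t = indicatrix_curve (K_loc K a) c (tcoord a u) X t.
  by move=> te; have [] := gamP t te.
have z0 : `|0 : R| < e by rewrite normr0.
exists gam, e; split => //.
- have [av vE _] := gamP 0 z0; apply: (tcoord_inj av au).
  by rewrite vE c0.
- by move=> t te; have [] := gamP t te.
- move=> k; apply: eq_Ck (sc k); first exact: ball_open.
  by move=> t; rewrite -ball_normE /= sub0r normrN => te; exact: esym (gE t te).
rewrite -[RHS]dc !derive1E.
apply: (eq_derive_open (U := ball (0 : R^o) e)); first exact: ball_open.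
  exact: ballxx.
by move=> t; rewrite -ball_normE /= sub0r normrN => /gE.
Qed.

Lemma indicatrix_submanifold : submanifold (n + n).-1 N.
Proof.
split; first exact: leq_pred.
move=> u Nu; set a := at_ u; have au : tdom a u := tdom_at u.
have lc := cartan_local a; have Uu := image_tcoord au.
have /rV0Pn[k pk] := lc_neq0 lc Uu.
rewrite mxE in pk.
(* The index of a nonzero momentum forces [n > 0], so the predecessor of [n + n] really is
   codimension one. *)
have n0 : (0 < n + n)%N by rewrite ltn_addr // (leq_ltn_trans (leq0n k) (ltn_ord k)).
have ltm : ((n + n).-1 < n + n)%N by rewrite prednK.
have [Phi [Psi [oV sPhi sPsi PhiK PhiN]]] := slice_chart lc c pk (Ordinal ltm).
pose D := slice_domain (tcoord a @` tdom a) k (tcoord a u).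
exists D, (Phi @` D), Phi, Psi.
split.
- split => //; first exact: (slice_domain_open lc).
    exact: (slice_domain_y0 Uu pk).
  by move=> y [].
- by split.
move=> v av Dv; rewrite (indicatrix_loc av) (PhiN _ Dv).
split=> [E i im|E]; last by apply: E.
(* The slice condition concerns only the last index, the slot chosen for [slice_chart]. *)
have -> // : i = Ordinal ltm.
by apply: val_inj => /=; apply/eqP; rewrite eqn_leq im andbT -ltnS prednK.
Qed.

Lemma pushE a u X : tdom a u ->
  push (A := TM0) a u X = 'D_X (ttrans (at_ u) a) (tcoord (at_ u) u).
Proof.
by move=> au; rewrite deriveE //; exact: (ttrans_diff (tdom_at u) au).
Qed.

(** Membership in [D v] is a pair of equations read in [chart_at v]. Both are unchanged when the
    vector is pushed to [chart_at u], where the smooth fields [frame_D] span the solutions. *)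
Lemma D_distribution : distribution (n + n - 2) N
  (fun u => (H_xi_distr K u + V_C_distr K u)%VS).
Proof.
move=> u Nu; set a := at_ u; have au : tdom a u := tdom_at u.
have lc := cartan_local a; have Uu := image_tcoord au.
split.
- exact: (dim_D lc Uu).
- by move=> X /(memv_D lc Uu)[dX _]; apply/(tangent_indicatrix _ Nu).
exists (tcoord a @` tdom a), (n + n)%N, (frame_D (K_loc K a)); split=> //.
- exact: (lc_open lc).
- by move=> i; exact: (frame_D_smooth lc).
move=> v Nv av Uv X.
have bv := tdom_at v; have lcb := cartan_local (at_ v).
apply/idP/idP.
  move=> /(memv_D lcb (image_tcoord bv))[dX tX].
  apply/(mem_frame_D lc _ Uv); rewrite (pushE _ av).
  by rewrite (derive_K_loc_ttrans _ bv av) (liouville_form_ttrans _ bv av).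
move=> /(mem_frame_D lc _ Uv); rewrite (pushE _ av).
rewrite (derive_K_loc_ttrans _ bv av) (liouville_form_ttrans _ bv av).
by move=> h; apply/(memv_D lcb (image_tcoord bv)).
Qed.

Lemma xi_distribution : distribution 1 N (xi_distr K).
Proof.
move=> u Nu; set a := at_ u; have au : tdom a u := tdom_at u.
have lc := cartan_local a; have Uu := image_tcoord au.
split.
- exact: (dim_D' lc Uu).
- move=> X /memv_D'[k ->]; apply/(tangent_indicatrix _ Nu).
  by rewrite (dLZ lc Uu) (dL_liouville_h lc Uu) mulr0.
exists (tcoord a @` tdom a), 1%N, (fun=> hamilton_field (K_loc K a)); split=> //.
- exact: (lc_open lc).
- by move=> _; exact: (hamilton_field_smooth lc).
move=> v Nv av Uv X.
have bv := tdom_at v; have lcb := cartan_local (at_ v).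
have Ubv := image_tcoord bv; have xiE := liouville_hE lcb Ubv.
have dT := ttrans_diff bv av.
have DZ k Z : 'D_(k *: Z) (ttrans (at_ v) a) (tcoord (at_ v) v) =
    k *: 'D_Z (ttrans (at_ v) a) (tcoord (at_ v) v).
  by rewrite !deriveE // linearZ.
apply/idP/idP.
  move=> /memv_D'[k ->]; apply/span_enumP; exists (fun=> k).
  rewrite big_ord1 (pushE _ av) DZ xiE; congr (_ *: _).
  exact: hamilton_field_ttrans.
(* The opposite transition undoes the push, so a vector whose push is a multiple of the field in
   [chart_at u] is itself a multiple of xi^*. *)
move=> /span_enumP[k]; rewrite big_ord1 (pushE _ av) => E.
have E' : 'D_X (ttrans (at_ v) a) (tcoord (at_ v) v) =
    'D_(k ord0 *: hamilton_field (K_loc K (at_ v)) (tcoord (at_ v) v))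
      (ttrans (at_ v) a) (tcoord (at_ v) v).
  apply: (etrans E); apply: (etrans _ (esym (DZ _ _))).
  exact: (congr1 ( *:%R (k ord0)) (esym (hamilton_field_ttrans bv av))).
apply/memv_D'; exists (k ord0); rewrite xiE.
apply: (etrans (esym (ttransK X bv av))); apply: (etrans _ (ttransK _ bv av)).
exact: (congr1 (fun W => 'D_W (ttrans a (at_ v)) (tcoord a v)) E').
Qed.

End Level.
End CartanCR.

Theorem proposition5p1 (R : realType) (n : nat) (M : manifold R n)
    (K : cotangent M -> R) (hK : cartan_structure K) (c : R) (hc : 0 < c) :
  (forall u, indicatrix K c u -> directv (H_xi_distr K u + V_C_distr K u)) /\
  CR_submanifold (cartan_metric K) (cartan_acs K) (indicatrix K c)
    (fun u => (H_xi_distr K u + V_C_distr K u)%VS) (xi_distr K).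
Proof.
have lc u := cartan_local hK (@chart_at R (n + n) (cotangent0_atlas M) u).
have Uu u := image_tcoord (@tdom_at R n M u).
split=> [u _|]; first exact: (directv_D (lc u) (Uu u)).
split.
- by exists (n + n).-1; exact: (indicatrix_submanifold hK c).
- by exists (n + n - 2)%N; exact: (D_distribution hK hc).
- by exists 1%N; exact: (xi_distribution hK hc).
- by move=> u _; apply/directv_addP; exact: (capv_D_D' (lc u) (Uu u)).
- move=> u Nu X; rewrite (tangent_indicatrix hK hc X Nu).
  by rewrite -(memv_DD' (lc u) (Uu u)).
- by move=> u _ X Y; exact: (metric_D_D' (lc u) (Uu u)).
- by move=> u _ X; exact: (acs_D (lc u) (Uu u)).
move=> u Nu X Y X_xi /(tangent_indicatrix hK hc Y Nu) dY.
exact: (metric_acs_D' (lc u) (Uu u)).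
Qed.
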